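(* Let $T\ge1$ and let $x_T$ be the final iterate of the Stochastic Continuous Greedy (SCG) method (defined in the context) for the problem $\max_{x\in C}F(x)$. Suppose that: (1) $\|x\|\le D$ for all $x\in C$; (2) $F$ is DR-submodular and monotone, and $\|\nabla F(x)-\nabla F(y)\|\le L\|x-y\|$ for all $x,y\in\mathcal{X}$; (3) the stochastic gradients are unbiased, $\mathbb{E}_{z\sim P}[\nabla\tilde F(x,z)]=\nabla F(x)$, and $\mathbb{E}_{z\sim P}\big[\|\nabla\tilde F(x,z)-\nabla F(x)\|^2\big]\le\sigma^2$ for all $x\in\mathcal{X}$. If $\rho_t=\frac{4}{(t+8)^{2/3}}$, then $$\mathbb{E}[F(x_T)]\ge(1-1/e)\,\mathrm{OPT}-\frac{15DQ^{1/2}}{T^{1/3}}-\frac{LD^2}{2T},$$ where $\mathrm{OPT}=\max_{x\in C}F(x)$ and $Q:=\max\{4\|\nabla F(x_0)-d_0\|^2,\ 16\sigma^2+2L^2D^2\}$.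
   Context: Setting: $\mathcal{X}=\prod_{i=1}^n\mathcal{X}_i\subset\mathbb{R}_+^n$, where each $\mathcal{X}_i$ is a compact subset of $\mathbb{R}_+$; $C\subseteq\mathcal{X}$ is a compact convex set (a convex body, not necessarily down-closed and not necessarily containing $0$). $z$ is a random variable with distribution $P$ taking values in a set $\mathcal{Z}$, $\tilde F:\mathcal{X}\times\mathcal{Z}\to\mathbb{R}_+$ is a stochastic function, and $F:\mathcal{X}\to\mathbb{R}_+$ is $F(x)=\mathbb{E}_{z\sim P}[\tilde F(x,z)]$. $F$ is differentiable; the functions $\tilde F(\cdot,z)$ need not be monotone or submodular. $\|\cdot\|$ is the Euclidean norm, and vector inequalities are componentwise. $F$ is monotone if $x\le y\Rightarrow F(x)\le F(y)$ for $x,y\in\mathcal{X}$. A differentiable $F$ is DR-submodular if it is submodular, i.e. $F(x)+F(y)\ge F(x\vee y)+F(x\wedge y)$ for all $x,y\in\mathcal X$ ($\vee,\wedge$ the componentwise max and min), and its gradient is antitone: $x\le y\Rightarrow\nabla F(x)\ge\nabla F(y)$ for $x,y\in\mathcal{X}$. SCG method with $T$ iterations and averaging parameters $\rho_t>0$: $x_0=d_0=0$; with independent samples $z_1,z_2,\dots\sim P$, $$d_t=(1-\rho_t)d_{t-1}+\rho_t\nabla\tilde F(x_t,z_t)\quad(t\ge1),$$ $$v_t\in\arg\max_{v\in C}d_t^Tv,\qquad x_{t+1}=x_t+\frac1Tv_t\quad(t=0,1,\dots,T-1).$$ (Since $d_0=0$, $v_0$ is an arbitrary point of $C$.) The expectation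 is over all the samples.
   Formalization: Each X_i is assumed to contain [0, y_i] for all y in C, since otherwise x_0 = 0 and the iterates may leave X, where F and its gradient are undefined; v_t depends measurably on z_1,…,z_t only, the stochastic gradient is jointly measurable, and L ≥ 0. *)

(* Defs.v *)
From HB Require Import structures.
From mathcomp Require Import all_boot all_order all_algebra.
From mathcomp Require Import finmap.
From mathcomp Require Import all_classical all_reals all_analysis.
Import Order.TTheory GRing.Theory Num.Theory.
Import numFieldNormedType.Exports.

Set Implicit Arguments.
Unset Strict Implicit.
Unset Printing Implicit Defensive.

Local Open Scope classical_set_scope.
Local Open Scope ring_scope.

Section Vectors.
Context {R : realType} {n : nat}.
Implicit Types (u v x y : 'rV[R]_n) (X : set 'rV[R]_n).

Definition inner u v : R := \sum_(i < n) u 0 i * v 0 i.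

(* The library norm on 'rV[R]_n is the sup norm, hence this definition. *)
Definition enorm u : R := Num.sqrt (\sum_(i < n) u 0 i ^+ 2).

Definition lev u v : Prop := forall i, u 0 i <= v 0 i.
Definition joinv u v : 'rV[R]_n := \row_i Num.max (u 0 i) (v 0 i).
Definition meetv u v : 'rV[R]_n := \row_i Num.min (u 0 i) (v 0 i).

Definition prod_set (X_ : 'I_n -> set R) : set 'rV[R]_n :=
  [set x | forall i, X_ i (x 0 i)].

(* First-order expansion relative to X: only the values of f on X matter, so
   that f may be a function defined on X alone and x a boundary point of X.
   At an interior point g x is the usual gradient. In a direction in which X is
   degenerate the gradient is not unique; g is then any choice of it. *)
Definition gradient_on X (f : 'rV[R]_n -> R) (g : 'rV[R]_n -> 'rV[R]_n) : Prop :=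
  forall x, X x -> forall e : R, 0 < e ->
    \forall y \near x, X y ->
      `|f y - f x - inner (g x) (y - x)| <= e * enorm (y - x).

Definition monotone_on X (f : 'rV[R]_n -> R) : Prop :=
  forall x y, X x -> X y -> lev x y -> f x <= f y.

Definition submodular_on X (f : 'rV[R]_n -> R) : Prop :=
  forall x y, X x -> X y -> f (joinv x y) + f (meetv x y) <= f x + f y.

Definition DR_submodular_on X (f : 'rV[R]_n -> R)
    (g : 'rV[R]_n -> 'rV[R]_n) : Prop :=
  submodular_on X f /\
  forall x y, X x -> X y -> lev x y -> lev (g y) (g x).

Definition argmax (C : set 'rV[R]_n) (f : 'rV[R]_n -> R) : set 'rV[R]_n :=
  [set v | C v /\ forall u, C u -> f u <= f v].

(* 'rV[R]_n with its Borel sigma-algebra *)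
Definition borel_rV := g_sigma_algebraType (@open 'rV[R]_n).

End Vectors.
Arguments borel_rV : clear implicits.

Definition is_max {R : realType} (A : set R) (m : R) : Prop :=
  A m /\ ubound A m.

Section Sampling.
Context {dZ dO : measure_display} {Z : measurableType dZ}
  {Omega : measurableType dO} {R : realType} (Pr : probability Omega R).

Definition mutually_independent (I : choiceType)
    (X : I -> {RV Pr >-> Z}) : Prop :=
  forall (J : {fset I}) (A : I -> set Z), (forall i, measurable (A i)) ->
    Pr (\bigcap_(i in [set` J]) (X i @^-1` A i)) =
    (\prod_(i <- J) Pr (X i @^-1` A i))%E.

(* The samples are z 1, z 2, ...; z 0 is unused. *)
Definition iid_samples (P : probability Z R) (z : nat -> {RV Pr >-> Z}) : Prop :=
  mutually_independent (fun t => z t.+1) /\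
  forall t (A : set Z), measurable A -> distribution Pr (z t.+1) A = P A.

(* sigma-algebra generated by z 1, ..., z t *)
Definition history (z : nat -> {RV Pr >-> Z}) (t : nat) : set (set Omega) :=
  <<s \bigcup_(s in [set s : nat | (1 <= s <= t)%N])
        preimage_set_system setT (z s) measurable >>.

(* Ties in the argmax are broken arbitrarily, but on the basis of the samples
   drawn so far: v t is measurable for the sigma-algebra of z 1, ..., z t. In
   particular v 0 is a constant, i.e. an arbitrary point of C. *)
Record scg_run {n : nat} (C : set 'rV[R]_n) (T : nat) (rho : nat -> R)
    (gFt : 'rV[R]_n -> Z -> 'rV[R]_n) (z : nat -> {RV Pr >-> Z})
    (x d v : nat -> Omega -> 'rV[R]_n) : Prop := ScgRun {
  scg_x0 : forall w, x 0%N w = 0 ;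
  scg_d0 : forall w, d 0%N w = 0 ;
  scg_d : forall t w, (t.+1 < T)%N ->
    d t.+1 w = (1 - rho t.+1) *: d t w + rho t.+1 *: gFt (x t.+1 w) (z t.+1 w) ;
  scg_v : forall t w, (t < T)%N -> argmax C (inner (d t w)) (v t w) ;
  scg_x : forall t w, (t < T)%N -> x t.+1 w = x t w + T%:R^-1 *: v t w ;
  scg_adapted : forall t, (t < T)%N ->
    preimage_set_system setT (v t) <<s @open 'rV[R]_n >> `<=` history z t
}.

End Sampling.

(* Main.v *)
Require Import Defs.
From HB Require Import structures.
From mathcomp Require Import all_boot all_order all_algebra.
From mathcomp Require Import finmap ring lra.
From mathcomp Require Import all_classical all_reals all_analysis.
From mathcomp Require Import measurable_realfun.
Import Order.TTheory GRing.Theory Num.Theory.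
Import numFieldNormedType.Exports.

Set Implicit Arguments.
Unset Strict Implicit.
Unset Printing Implicit Defensive.

Local Open Scope classical_set_scope.
Local Open Scope ring_scope.

(** The method is a continuous greedy ascent with a noisy gradient. Write [Delta_t] for
    the difference between [gF (x_t)] and the running average [d_t].

    A function with antitone gradient is concave in nonnegative directions.
    Going from [x] to [max(x, y)], this bounds the gap [F y - F x] by the inner product
    of [gF x] with [y] ([optimum_gap]). Since [v_t] maximizes the inner product with
    [d_t] over [C], a step of length [1/T] along [v_t] shrinks the gap by the factor
    [1 - 1/T], up to an error [2 D |Delta_t| / T] for using [d_t] in place of
    [gF (x_t)], and a second-order error [L D^2 / (2 T^2)] ([greedy_step]). After [T]
    steps the initial gap has been multiplied by at most [1/e] ([greedy_gap]); this
    holds for every sample path.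

    It remains to bound the mean of [|Delta_t|]. Averaging reduces the variance: the
    noise enters with weight [rho], and being centred given the past it adds only
    [rho^2 sigma^2] to the mean square ([zero_mean_noise]), while the old error is
    multiplied by [1 - rho] and the drift of the true gradient is at most
    [L D / T] ([error_step]). With [rho = 4 / (t + 8)^(2/3)] the mean square stays below
    [4 Q / (t + 9)^(2/3)] ([error_recursion], [error_bound]), so that the errors
    [2 D |Delta_t| / T] add up to order [D sqrt Q / T^(1/3)] ([fine_bound]).

    The conditional expectation given the past is replaced by Tonelli's theorem: the
    past and the next sample are independent, so that an expectation over both is an
    iterated integral in which the past is a parameter ([freezing]). Only nonnegative
    integrands occur there, so that the mean squares can be handled as extended reals.

    The recursion uses [T + 7 <= 2 T], and the last argument uses [0 < Q]. When [T < 8]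
    or [Q = 0] the bound is elementary, because the starting point already satisfies
    [F 0 >= F y - D sqrt Q / 2] ([coarse_bound]). *)

(** * Euclidean norm and inner product *)

Section EuclideanSpace.
Context {R : realType} {n : nat}.
Implicit Types u v w x y : 'rV[R]_n.

Lemma innerC u v : inner u v = inner v u.
Proof. by apply: eq_bigr => i _; rewrite mulrC. Qed.

Lemma innerDr u v w : inner u (v + w) = inner u v + inner u w.
Proof. by rewrite -big_split; apply: eq_bigr => i _; rewrite mxE mulrDr. Qed.

Lemma innerZr a u v : inner u (a *: v) = a * inner u v.
Proof. by rewrite /inner big_distrr; apply: eq_bigr => i _; rewrite mxE mulrCA. Qed.

Lemma innerZl a u v : inner (a *: u) v = a * inner u v.
Proof. by rewrite innerC innerZr innerC. Qed.

Lemma innerNr u v : inner u (- v) = - inner u v.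
Proof. by rewrite -scaleN1r innerZr mulN1r. Qed.

Lemma innerBr u v w : inner u (v - w) = inner u v - inner u w.
Proof. by rewrite innerDr innerNr. Qed.

Lemma innerBl u v w : inner (v - w) u = inner v u - inner w u.
Proof. by rewrite innerC innerBr ![inner u _]innerC. Qed.

Lemma inner0r u : inner u 0 = 0.
Proof. by rewrite -[0](scale0r u) innerZr mul0r. Qed.

Lemma ler_innerl u v w : lev 0 w -> lev u v -> inner u w <= inner v w.
Proof.
move=> w0 uv; apply: ler_sum => i _; apply: ler_wpM2r; last exact: uv.
by have := w0 i; rewrite mxE.
Qed.

Lemma enorm_ge0 u : 0 <= enorm u.
Proof. exact: sqrtr_ge0. Qed.

Lemma enorm_sqr u : enorm u ^+ 2 = \sum_(i < n) u 0 i ^+ 2.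
Proof. by rewrite sqr_sqrtr// sumr_ge0// => i _; rewrite sqr_ge0. Qed.

Lemma enorm_sqrE u : enorm u ^+ 2 = inner u u.
Proof. by rewrite enorm_sqr; apply: eq_bigr => i _; rewrite expr2. Qed.

Lemma enormZ a u : enorm (a *: u) = `|a| * enorm u.
Proof.
apply/eqP; rewrite -(@eqrXn2 _ 2)//; last 2 first.
- exact: enorm_ge0.
- by rewrite mulr_ge0// enorm_ge0.
by rewrite exprMn !enorm_sqrE innerZr innerZl mulrA real_normK ?num_real// expr2.
Qed.

Lemma enormN u : enorm (- u) = enorm u.
Proof. by rewrite -scaleN1r enormZ normrN1 mul1r. Qed.

Lemma enorm_eq0 u : enorm u = 0 -> u = 0.
Proof.
move=> /(congr1 (fun a => a ^+ 2)); rewrite enorm_sqr expr0n => /eqP.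
rewrite psumr_eq0 => [/allP u0|i _]; last exact: sqr_ge0.
apply/rowP => i; rewrite mxE; apply/eqP; rewrite -sqrf_eq0.
by apply: u0; rewrite mem_index_enum.
Qed.

(** The Cauchy-Schwarz inequality, from [0 <= |b u - a v|^2] at [a = |u|] and
    [b = |v|]. *)
Lemma inner_le_enorm u v : inner u v <= enorm u * enorm v.
Proof.
have [/enorm_eq0 ->|u0] := eqVneq (enorm u) 0.
  by rewrite innerC inner0r mulr_ge0// enorm_ge0.
have [/enorm_eq0 ->|v0] := eqVneq (enorm v) 0.
  by rewrite inner0r mulr_ge0// enorm_ge0.
have ab : 0 < enorm u * enorm v by rewrite mulr_gt0// lt0r ?u0 ?v0 enorm_ge0.
have := sqr_ge0 (enorm (enorm v *: u - enorm u *: v)).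
rewrite enorm_sqrE innerBl !innerBr !innerZl !innerZr -!enorm_sqrE (innerC v u).
move=> h.
rewrite -subr_ge0 -(pmulr_rge0 _ ab); lra.
Qed.

Lemma enormD u v : enorm (u + v) <= enorm u + enorm v.
Proof.
rewrite -(@ler_pXn2r _ 2) ?nnegrE ?addr_ge0 ?enorm_ge0//.
rewrite sqrrD !enorm_sqrE innerDr !(innerC (u + v)) !innerDr (innerC v u).
have := inner_le_enorm u v; lra.
Qed.

Lemma ler_abs_inner u v : `|inner u v| <= enorm u * enorm v.
Proof.
rewrite ler_norml inner_le_enorm andbT lerNl -innerNr.
by rewrite (le_trans (inner_le_enorm _ _))// enormN.
Qed.

Lemma ler_coord_enorm u i : `|u 0 i| <= enorm u.
Proof.
rewrite -sqrtr_sqr ler_wsqrtr// (bigD1 i)//= lerDl sumr_ge0// => j _.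
exact: sqr_ge0.
Qed.

(** The weighted form of [|u + v|^2 <= 2|u|^2 + 2|v|^2]: the error recursion
    leaves no room for a factor 2 in front of [|u|^2]. *)
Lemma enormD_young b u v : 0 < b ->
  enorm (u + v) ^+ 2 <= (1 + b) * enorm u ^+ 2 + (1 + b^-1) * enorm v ^+ 2.
Proof.
move=> b0; rewrite !enorm_sqr !big_distrr -big_split; apply: ler_sum => i _.
rewrite mxE /=; have bb : b * b^-1 = 1 by rewrite divff// gt_eqF.
have c0 : 0 < b^-1 by rewrite invr_gt0.
set p := u 0 i; set q := v 0 i.
have := mulr_ge0 (ltW c0) (sqr_ge0 (b * p - q)).
have -> : b^-1 * (b * p - q) ^+ 2 =
  (b * b^-1) * b * p ^+ 2 - 2 * (b * b^-1) * p * q + b^-1 * q ^+ 2 by ring.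
rewrite bb; lra.
Qed.

(** Neighbourhoods of row vectors are those of the sup norm, which controls the
    Euclidean norm up to the dimension. *)
Lemma enorm_near x e : 0 < e -> \forall y \near x, enorm (y - x) < e.
Proof.
move=> e0; have k0 : 0 < e / n.+1%:R by rewrite divr_gt0.
apply: filterS (nbhsx_ballx x _ k0) => y [_ xy].
suff : enorm (y - x) <= n%:R * (e / n.+1%:R).
  move/le_lt_trans; apply; rewrite mulrCA gtr_pMr// ltr_pdivrMr//.
  by rewrite mul1r ltr_nat.
rewrite -(@ler_pXn2r _ 2) ?nnegrE ?enorm_ge0 ?mulr_ge0 ?invr_ge0 ?(ltW e0)//.
rewrite enorm_sqr.
have cle i : (y - x) 0 i ^+ 2 <= (e / n.+1%:R) ^+ 2.
  rewrite -real_normK ?num_real// lerXn2r ?nnegrE ?(ltW k0)//.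
  by rewrite !mxE distrC; exact: ltW (xy 0 i).
apply: (le_trans (ler_sum _ (fun i _ => cle i))).
move: (e / _) => c; rewrite sumr_const card_ord -[leLHS]mulr_natl exprMn.
rewrite ler_wpM2r ?sqr_ge0//.
by case: (n) => [|m]; rewrite ?expr0n// expr2 ler_peMr// ler1n.
Qed.

Lemma line_continuous x u : continuous (fun s : R => x + s *: u).
Proof.
move=> t; have tu : s *: u @[s --> t] --> t *: u by exact: scalel_continuous.
have cx : x @[s --> t] --> x by exact: cvg_cst.
exact: (cvgD cx tu).
Qed.

Lemma near_line x u t (A : 'rV[R]_n -> Prop) :
  (\forall y \near x + t *: u, A y) -> \forall s \near t, A (x + s *: u).
Proof. exact: line_continuous. Qed.

End EuclideanSpace.

(** * First-order calculus on a domain with boundary *)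

Section Gradient.
Context {R : realType} {n : nat}.
Variables (X : set 'rV[R]_n) (F : 'rV[R]_n -> R) (g : 'rV[R]_n -> 'rV[R]_n).
Hypothesis gradF : gradient_on X F g.
Implicit Types u x y : 'rV[R]_n.

Lemma gradient_line x u t e : 0 < e -> X (x + t *: u) ->
  \forall s \near t, X (x + s *: u) ->
    `|F (x + s *: u) - F (x + t *: u) - (s - t) * inner (g (x + t *: u)) u|
      <= e * `|s - t|.
Proof.
move=> e0 Xt; have k0 : 0 < e / (enorm u + 1).
  by rewrite divr_gt0// ltr_wpDl// enorm_ge0.
apply: filterS (near_line (gradF Xt k0)) => s /[apply].

have -> : x + s *: u - (x + t *: u) = (s - t) *: u.
  by rewrite [x + s *: u]addrC addrKA scalerBl.
rewrite innerZr enormZ => /le_trans; apply.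
rewrite mulrCA mulrC ler_wpM2r// mulrAC ler_pdivrMr ?ltr_wpDl ?enorm_ge0//.
by rewrite ler_wpM2l ?(ltW e0)// lerDl.
Qed.

Lemma gradient_continuous x e : X x -> 0 < e ->
  \forall y \near x, X y -> `|F y - F x| < e.
Proof.
move=> Xx e0; have K0 : 0 < enorm (g x) + 1 by rewrite ltr_wpDl// enorm_ge0.
near=> y => Xy.
have h1 : `|F y - F x - inner (g x) (y - x)| <= 1 * enorm (y - x).
  by move: Xy; near: y; exact: gradF.
have h2 : enorm (y - x) < e / (enorm (g x) + 1).
  by near: y; apply: enorm_near; rewrite divr_gt0.
rewrite -(subrK (inner (g x) (y - x)) (F y - F x)).
rewrite (le_lt_trans (ler_normD _ _))// (le_lt_trans (lerD h1 (ler_abs_inner _ _)))//.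
by rewrite -mulrDl addrC mulrC -ltr_pdivlMr.
Unshelve. all: by end_near. Qed.

(** The mean value theorem for [t |-> F (x + t u) + k t^2]. The quadratic term
    yields the sharp constant in the descent lemma below. *)
Lemma line_mean_value x u k :
  (forall t, 0 <= t <= 1 -> X (x + t *: u)) ->
  exists2 c, 0 < c < 1 &
    F (x + u) - F x + k = inner (g (x + c *: u)) u + 2 * c * k.
Proof.
move=> Xl; pose f (t : R) := F (x + t *: u).
pose h (t : R) := f t + k * t ^+ 2.
pose l t := inner (g (x + t *: u)) u.
have dsq t : is_derive t (1:R) (fun t : R => k * t ^+ 2) (2 * t * k).
  apply: is_derive_eq; rewrite -[LHS]/(k * (t * 1 + t * 1)); ring.
have df (t : R) : t \in `]0, 1[ -> is_derive t (1:R) f (l t).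
  rewrite in_itv /= => /andP[t0 t1].
  suff : h^-1 *: (f (h *: 1 + t) - f t) @[h --> 0^'] --> l t.
    move=> hc; apply: DeriveDef; first by apply/cvg_ex; exists (l t).
    by apply: cvg_lim => //; exact: Rhausdorff.
  apply/cvgrPdist_le => e e0.
  have Xt : X (x + t *: u) by apply: Xl; rewrite !ltW.
  have near_t := gradient_line e0 Xt.
  near=> s; have s0 : s != 0 by near: s; exact: nbhs_dnbhs_neq.
  have st0 : 0 <= s + t <= 1.
    suff : `|s| < Num.min t (1 - t).
      rewrite lt_min => /andP[]; rewrite !ltr_norml => /andP[? ?] /andP[? ?].
      by apply/andP; split; lra.
    near: s; apply: dnbhs0_lt; rewrite lt_min; apply/andP; split; lra.
  have : `|f (s + t) - f t - (s + t - t) * l t| <= e * `|s + t - t|.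
    move: (Xl _ st0); rewrite /f; near: s.
    have st : s + t @[s --> 0^'] --> t.
      rewrite -[X in _ --> X]add0r; apply: cvgD; last exact: cvg_cst.
      exact: nbhs_dnbhs.
    exact: (st _ near_t).
  rewrite addrK => hs.
  rewrite -[s *: 1]/(s * 1) mulr1 -[_ *: _]/(s^-1 * _).
  rewrite -(ler_pM2l (_ : 0 < `|s|)) ?normr_gt0// -normrM mulrBr mulVKf//.
  by rewrite distrC [leRHS]mulrC.
have dh (t : R) : t \in `]0, 1[ -> is_derive t (1:R) h (l t + 2 * t * k).
  by move=> /df ?; apply: is_deriveD.
have fc : {within `[0, 1], continuous f}.
  apply/subspace_continuousP => t /=; rewrite in_itv /= => t01.
  apply/cvgrPdist_lt => e e0; have near_f := gradient_continuous (Xl _ t01) e0.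
    apply: filterS (near_line near_f) => s /= + s01.
  by rewrite distrC; apply; apply: Xl; rewrite in_itv in s01.
have hc : {within `[0, 1], continuous h}.
  move=> t; apply: continuousD; first exact: fc.
  apply: continuous_subspaceT => {}t; apply: cvgM; first exact: cvg_cst.
  exact: exprn_continuous.
have [c] := MVT ltr01 dh hc.
rewrite in_itv /= subr0 mulr1 /h /f scale1r scale0r addr0 expr1n expr0n /=.
rewrite mulr1 mulr0 addr0 => c01 E; exists c => //; rewrite -E; ring.
Unshelve. all: by end_near. Qed.

End Gradient.

Section GradientOnOrderedDomain.
Context {R : realType} {n : nat}.
Variables (X : set 'rV[R]_n) (F : 'rV[R]_n -> R) (g : 'rV[R]_n -> 'rV[R]_n).
Hypothesis gradF : gradient_on X F g.
Implicit Types u x y : 'rV[R]_n.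

(** Where [X] is degenerate the vector [g x] may have negative coordinates, so
    that monotonicity only controls its inner product with feasible directions. *)
Lemma inner_gradient_ge0 x u : monotone_on X F -> lev 0 u ->
  (forall t, 0 <= t <= 1 -> X (x + t *: u)) -> 0 <= inner (g x) u.
Proof.
move=> monF u0 Xl; rewrite leNgt; apply/negP; set l := inner _ _ => l0.
have Xx : X x by rewrite -(addr0 x) -(scale0r u); apply: Xl; rewrite lexx ler01.
have e0 : 0 < - l / 2 by lra.
have X0 : X (x + 0 *: u) by rewrite scale0r addr0.
have /nbhs_ballP[r /= r0 near0] := gradient_line gradF e0 X0.
pose s := Num.min (r / 2) 1.
have s0 : 0 < s by rewrite lt_min ltr01 andbT divr_gt0.
have s01 : 0 <= s <= 1 by rewrite (ltW s0) ge_min lexx orbT.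
have Xs := Xl _ s01.
have : ball 0 r s.
  rewrite /ball /= sub0r normrN gtr0_norm// (@le_lt_trans _ _ (r / 2))//; last lra.
  by rewrite ge_min lexx.
move/near0 => /(_ Xs); rewrite scale0r addr0 subr0 -/l (gtr0_norm s0) => lin.
have : F x <= F (x + s *: u).
  apply: monF => // i; rewrite !mxE lerDl mulr_ge0 ?(ltW s0)//.
  by have := u0 i; rewrite mxE.
have : s * l < 0 by rewrite pmulr_rlt0.
move: lin; rewrite ler_norml => /andP[_]; lra.
Qed.

(** Along a nonnegative direction an antitone gradient decreases, so that its value
    at the intermediate point is below the one at [x]. *)
Lemma DR_concave x u : (forall a b, X a -> X b -> lev a b -> lev (g b) (g a)) ->
  lev 0 u -> (forall t, 0 <= t <= 1 -> X (x + t *: u)) ->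
  F (x + u) - F x <= inner (g x) u.
Proof.
move=> anti u0 Xl; have [c /andP[c0 c1]] := line_mean_value gradF 0 Xl.
rewrite mulr0 !addr0 => ->; apply: ler_innerl => //; apply: anti.
- by rewrite -(addr0 x) -(scale0r u); apply: Xl; rewrite lexx ler01.
- by apply: Xl; rewrite !ltW.
- move=> i; rewrite !mxE lerDl mulr_ge0 ?(ltW c0)//.
  by have := u0 i; rewrite mxE.
Qed.

(** At the intermediate point [x + c u] the gradient has moved by at most
    [c L |u|]; the term [k t^2] with [k = L/2 |u|^2] compensates exactly this. *)
Lemma lipschitz_gradient_descent L x u :
  (forall a b, X a -> X b -> enorm (g a - g b) <= L * enorm (a - b)) ->
  (forall t, 0 <= t <= 1 -> X (x + t *: u)) ->
  inner (g x) u - L / 2 * enorm u ^+ 2 <= F (x + u) - F x.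
Proof.
move=> lip Xl; have Xx : X x.
  by rewrite -(addr0 x) -(scale0r u); apply: Xl; rewrite lexx ler01.
have [c /andP[c0 c1]] := line_mean_value gradF (L / 2 * enorm u ^+ 2) Xl.
set y := x + c *: u => E.
have Xy : X y by apply: Xl; rewrite !ltW.
have : - (enorm (g y - g x) * enorm u) <= inner (g y - g x) u.
  by rewrite lerNl (le_trans _ (ler_abs_inner _ _))// -normrN ler_norm.
have : enorm (g y - g x) * enorm u <= c * L * enorm u ^+ 2.
  rewrite expr2 mulrA ler_wpM2r ?enorm_ge0// (le_trans (lip _ _ Xy Xx))//.
  by rewrite /y [x + _]addrC addrK enormZ gtr0_norm// mulrA (mulrC c).
rewrite innerBl; move: E; lra.
Qed.

End GradientOnOrderedDomain.

(** * One step of the continuous greedy method *)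

Section ContinuousGreedy.
Context {R : realType} {n : nat}.
Variables (X_ : 'I_n -> set R) (C : set 'rV[R]_n).
Let X := prod_set X_.
Hypothesis X_ge0 : forall i a, X_ i a -> 0 <= a.
Hypothesis convC : convex_set C.
Hypothesis CX : C `<=` X.
Hypothesis CX_box : forall y i a, C y -> 0 <= a <= y 0 i -> X_ i a.
Implicit Types (u v x y : 'rV[R]_n) (t T : nat).

Lemma constraint_ge0 y i : C y -> 0 <= y 0 i.
Proof. by move=> /CX /(_ i); exact: X_ge0. Qed.

Lemma box_domain y u : C y -> (forall i, 0 <= u 0 i <= y 0 i) -> X u.
Proof. by move=> Cy uy i; apply: CX_box Cy (uy i). Qed.

Lemma convex_combination p y v : 0 <= p <= 1 -> C y -> C v ->
  C (p *: y + (1 - p) *: v).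
Proof.
move=> /andP[p0 p1] Cy Cv.
have := @convC y v (Itv01 p0 p1); rewrite !inE => /(_ Cy Cv).
by [].
Qed.

(** The t-th iterate of the method is [t/T] times the average of the directions taken
    so far, a point of [C]; this is the induction step. *)
Lemma average_step t T y v : C y -> C v ->
  exists2 y', C y' &
    (t%:R / T%:R) *: y + T%:R^-1 *: v = (t.+1%:R / T%:R) *: y'.
Proof.
move=> Cy Cv; exists (t%:R / t.+1%:R *: y + (1 - t%:R / t.+1%:R) *: v).
  apply: convex_combination => //.
  by rewrite divr_ge0//= ler_pdivrMr ?ltr0n// mul1r ler_nat.
have t0 : t.+1%:R != 0 :> R by rewrite pnatr_eq0.
set k := T%:R^-1; rewrite scalerDr !scalerA.
by congr (_ *: _ + _ *: _); field; rewrite addrC natr1.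
Qed.

Variables (F : 'rV[R]_n -> R) (g : 'rV[R]_n -> 'rV[R]_n).
Hypothesis gradF : gradient_on X F g.
Hypothesis antitone_g : forall a b, X a -> X b -> lev a b -> lev (g b) (g a).
Hypothesis monF : monotone_on X F.

(** Moving from [x] to [max(x, y)] gains at least [F y - F x], and at most the
    inner product with [g x] by concavity along that direction; the rest of [y],
    namely [min(x, y)], is a feasible direction and contributes nonnegatively. *)
Lemma optimum_gap a x y : 0 < a -> X x -> C y ->
  (forall i s, x 0 i <= s <= x 0 i + a * y 0 i -> X_ i s) ->
  F y - F x <= inner (g x) y.
Proof.
move=> a0 Xx Cy Xa; set j := joinv x y.
have x0 i : 0 <= x 0 i by exact: X_ge0 (Xx i).
have y0 i : 0 <= y 0 i by exact: constraint_ge0.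
have Xj : X j.
  by move=> i; rewrite mxE; case: leP => _; [exact: CX Cy i | exact: Xx i].
have h1 : F y <= F j.
  by apply: monF => //; [exact: CX|move=> i; rewrite mxE le_max lexx orbT].
have h2 : F (x + (j - x)) - F x <= inner (g x) (j - x).
  apply: (DR_concave gradF antitone_g) => [i|t /andP[t0 t1] i]; rewrite !mxE.
    by rewrite subr_ge0 le_max lexx.
  case: (leP (x 0 i) (y 0 i)) => xy; last by rewrite subrr mulr0 addr0; exact: Xx i.
  have d0 : 0 <= y 0 i - x 0 i by rewrite subr_ge0.
  apply: CX_box Cy _; have := mulr_ge0 t0 d0; have := ler_piMl d0 t1.
  by have := x0 i; lra.
have h3 : 0 <= inner (g x) (a *: meetv x y).
  apply: (inner_gradient_ge0 gradF monF) => [i|t /andP[t0 t1] i]; rewrite !mxE.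
    by rewrite mulr_ge0 ?(ltW a0)// le_min x0 y0.
  have m0 : 0 <= Num.min (x 0 i) (y 0 i) by rewrite le_min x0 y0.
  have m1 : Num.min (x 0 i) (y 0 i) <= y 0 i by rewrite ge_min lexx orbT.
  apply: Xa; rewrite lerDl lerD2l !mulr_ge0 ?(ltW a0)//=.
  by rewrite (le_trans (ler_piMl _ t1)) ?mulr_ge0 ?(ltW a0)// ler_wpM2l ?(ltW a0).
have h4 : y = j - x + meetv x y.
  by apply/rowP => i; rewrite !mxE; case: leP => _; rewrite ?addrN ?add0r ?subrK.
move: h3; rewrite innerZr pmulr_rge0// => h3.
rewrite {2}h4 innerDr; move: h2; rewrite (addrC x) subrK; lra.
Qed.

Variables (D L : R).
Hypothesis C_bounded : forall y, C y -> enorm y <= D.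
Hypothesis L_ge0 : 0 <= L.
Hypothesis lip_g :
  forall a b, X a -> X b -> enorm (g a - g b) <= L * enorm (a - b).

(** The direction [v] maximizes the inner product with [d] and not with [g x].
    Exchanging the two vectors costs [|g x - d|] times the distance from [v] to [y],
    which is at most [2 D]. *)
Lemma greedy_step t T x d v y : (t < T)%N ->
  (exists2 y', C y' & x = (t%:R / T%:R) *: y') ->
  argmax C (inner d) v -> C y ->
  F y - F (x + T%:R^-1 *: v) <= (1 - T%:R^-1) * (F y - F x)
    + 2 * D / T%:R * enorm (g x - d) + L * D ^+ 2 / (2 * T%:R ^+ 2).
Proof.
move=> tT [y' Cy' xE] [Cv vmax] Cy.
have T0 : 0 < T%:R :> R by rewrite ltr0n (leq_ltn_trans _ tT).
have Ti0 : 0 < T%:R^-1 :> R by rewrite invr_gt0.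
have TT : t.+1%:R / T%:R <= 1 :> R by rewrite ler_pdivrMr// mul1r ler_nat.
have x0 i : 0 <= x 0 i by rewrite xE mxE mulr_ge0 ?divr_ge0 ?(ltW T0)// constraint_ge0.
have ray w i s : C w -> x 0 i <= s <= x 0 i + T%:R^-1 * w 0 i -> X_ i s.
  move=> Cw /andP[xs sx]; have [z Cz zE] := average_step t T Cy' Cw.
  apply: (CX_box (i := i) Cz); rewrite (le_trans (x0 i) xs) (le_trans sx)//.
  have := congr1 (fun u : 'rV_n => u 0 i) zE; rewrite -xE !mxE => ->.
  by rewrite ler_piMl// constraint_ge0.
have Xx : X x.
  move=> i; apply: (ray v) => //; rewrite lexx lerDl mulr_ge0 ?(ltW Ti0)//.
  exact: constraint_ge0.
have gap : F y - F x <= inner (g x) y.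
  by apply: (optimum_gap Ti0) => // i s; exact: ray.
have desc : inner (g x) (T%:R^-1 *: v) - L / 2 * enorm (T%:R^-1 *: v) ^+ 2 <=
    F (x + T%:R^-1 *: v) - F x.
  apply: (lipschitz_gradient_descent gradF lip_g) => s /andP[s0 s1] i.
  have v0 : 0 <= T%:R^-1 * v 0 i by rewrite mulr_ge0 ?(ltW Ti0)// constraint_ge0.
  apply: (ray v) => //; rewrite !mxE lerDl lerD2l mulr_ge0//=.
  by rewrite ler_piMl.
have dir : inner (g x) y - 2 * D * enorm (g x - d) <= inner (g x) v.
  have := vmax _ Cy; have := ler_abs_inner (g x - d) (v - y).
  rewrite ler_norml innerBr !innerBl => /andP[+ _].
  have : enorm (g x - d) * enorm (v - y) <= enorm (g x - d) * (2 * D).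
    rewrite ler_wpM2l ?enorm_ge0// (le_trans (enormD _ _))// enormN.
    by rewrite mulr_natl mulr2n lerD// C_bounded.
  lra.
have vD : L / 2 * enorm (T%:R^-1 *: v) ^+ 2 <= L * D ^+ 2 / (2 * T%:R ^+ 2).
  have -> : L * D ^+ 2 / (2 * T%:R ^+ 2) = L / 2 * (T%:R^-1 * D) ^+ 2.
    by field; rewrite gt_eqF.
  rewrite enormZ gtr0_norm// ler_wpM2l ?divr_ge0// lerXn2r ?nnegrE//.
  - by rewrite mulr_ge0 ?(ltW Ti0) ?enorm_ge0.
  - by rewrite mulr_ge0 ?(ltW Ti0)// (le_trans (enorm_ge0 v))// C_bounded.
  - by rewrite ler_wpM2l ?(ltW Ti0)// C_bounded.
move: desc; rewrite innerZr => desc.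
have : T%:R^-1 * (F y - F x - 2 * D * enorm (g x - d)) <= T%:R^-1 * inner (g x) v.
  by rewrite ler_wpM2l ?(ltW Ti0)//; lra.
set k := T%:R^-1 in desc vD *; lra.
Qed.

End ContinuousGreedy.

(** * Step sizes and recursions *)

Section StepSizes.
Context {R : realType}.
Implicit Types (s u w p q : R) (t T : nat).

Definition cbrt s : R := s `^ (1 / 3).

Lemma cbrt_ge0 s : 0 <= cbrt s. Proof. exact: powR_ge0. Qed.

Lemma cbrtK s : 0 <= s -> cbrt s ^+ 3 = s.
Proof.
move=> s0; rewrite /cbrt -powR_mulrn ?powR_ge0// -powRrM.
by rewrite div1r mulVf ?powRr1.
Qed.

Lemma powR_two_thirds s : 0 <= s -> s `^ (2 / 3) = cbrt s ^+ 2.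
Proof.
by move=> s0; rewrite /cbrt -powR_mulrn ?powR_ge0// -powRrM mulrAC mul1r.
Qed.

Lemma cbrt_gt0 s : 0 < s -> 0 < cbrt s. Proof. exact: powR_gt0. Qed.

Lemma ler_cbrtX s q : 0 <= s -> 0 <= q -> s <= q ^+ 3 -> cbrt s <= q.
Proof.
by move=> s0 q0; rewrite -{1}(cbrtK s0) ler_pXn2r ?nnegrE ?cbrt_ge0.
Qed.

(** The bound [K/s^(2/3)] on the mean squared gradient error is reproduced by one
    step with [rho = 4/s^(2/3)]. The contraction [(1 - rho)^2 (1 + rho/2) <= 1 - rho/2]
    leaves [K (s^(-2/3) - s^(-4/3))], and this is at most [K/(s+1)^(2/3)] because
    [(s+1)^(2/3) <= s^(2/3) + 1]. Here [u^3 = s] and [w^3 = s + 1]. *)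
Lemma error_recursion rho K u w S M T :
  rho = 4 / u ^+ 2 -> 2 <= u -> 0 < w -> w ^+ 3 = u ^+ 3 + 1 ->
  0 <= S -> 0 <= M -> 16 * S + 2 * M <= K -> u ^+ 3 <= 2 * T%:R ->
  (1 - rho) ^+ 2 *
      ((1 + rho / 2) * (K / u ^+ 2) + (1 + (rho / 2)^-1) * (M / T%:R ^+ 2))
    + rho ^+ 2 * S <= K / w ^+ 2.
Proof.
move=> rhoE u2 w0 wu S0 M0 SMK uT.
have u0 : 0 < u by lra.
have K0 : 0 <= K by lra.
have u24 : 4 <= u ^+ 2 by have := mulr_ge0 (_ : 0 <= u - 2) (_ : 0 <= u + 2); lra.
have u20 : 0 < u ^+ 2 by lra.
have rho0 : 0 < rho by rewrite rhoE divr_gt0.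
have rho1 : rho <= 1 by rewrite rhoE ler_pdivrMr// mul1r.
have T0 : 0 < T%:R :> R by have : 0 < u ^+ 3 by [rewrite exprn_gt0|]; lra.
have w2 : w ^+ 2 <= u ^+ 2 + 1.
  have u3 : 0 < u ^+ 3 by rewrite exprn_gt0.
  rewrite -(@ler_pXn2r _ 3) ?nnegrE ?sqr_ge0 ?addr_ge0//; last lra.
  rewrite -exprM mulnC exprM wu.
  have -> : (u ^+ 2 + 1) ^+ 3 =
    (u ^+ 3 + 1) ^+ 2 + u ^+ 2 * (2 * u ^+ 2 - 2 * u + 3 + u ^+ 2) by ring.
  by rewrite lerDl mulr_ge0//; nra.
have c1 : (1 - rho) ^+ 2 * (1 + rho / 2) <= 1 - rho / 2.
  have -> : (1 - rho) ^+ 2 * (1 + rho / 2) =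
    1 - rho / 2 - (1 - rho) * (rho ^+ 2 / 2) - rho * (1 - rho / 2) by field.
  have := mulr_ge0 (_ : 0 <= 1 - rho) (_ : 0 <= rho ^+ 2 / 2).
  have := mulr_ge0 (_ : 0 <= rho) (_ : 0 <= 1 - rho / 2).
  have := sqr_ge0 rho; lra.
have c2 : (1 - rho) ^+ 2 * (1 + (rho / 2)^-1) <= u ^+ 2 / 2.
  have -> : u ^+ 2 / 2 = (rho / 2)^-1 by rewrite rhoE; field; rewrite gt_eqF.
  have -> : (1 - rho) ^+ 2 * (1 + (rho / 2)^-1) = (rho / 2)^-1 - 3 + rho ^+ 2.
    by field; rewrite gt_eqF.
  have : rho ^+ 2 <= 1 by rewrite expr_le1// ltW.
  lra.
have c3 : M / T%:R ^+ 2 <= 4 * M / u ^+ 6.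
  rewrite ler_pdivrMr ?exprn_gt0// mulrAC ler_pdivlMr ?exprn_gt0//.
  have : u ^+ 6 <= 4 * T%:R ^+ 2.
    have -> : 4 * T%:R ^+ 2 = (2 * T%:R) ^+ 2 :> R by ring.
    rewrite (_ : 6 = 3 * 2)%N // exprM lerXn2r ?nnegrE ?exprn_ge0 ?(ltW u0)//.
  by move=> /(ler_wpM2l M0); lra.
have s1 : (1 - rho) ^+ 2 * ((1 + rho / 2) * (K / u ^+ 2)) <=
    (1 - rho / 2) * (K / u ^+ 2).
  by rewrite mulrA ler_wpM2r// divr_ge0// ltW.
have s2 : (1 - rho) ^+ 2 * ((1 + (rho / 2)^-1) * (M / T%:R ^+ 2)) <=
    u ^+ 2 / 2 * (4 * M / u ^+ 6).
  have i0 : 0 <= (rho / 2)^-1 by rewrite invr_ge0; lra.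
  rewrite mulrA; apply: ler_pM => //.
    by rewrite mulr_ge0 ?sqr_ge0 ?addr_ge0.
  by rewrite divr_ge0// exprn_ge0 ?(ltW T0).
have s3 : (1 - rho / 2) * (K / u ^+ 2) + u ^+ 2 / 2 * (4 * M / u ^+ 6) + rho ^+ 2 * S
   = K * (u ^+ 2 - 1) / u ^+ 4 - (K - (16 * S + 2 * M)) / u ^+ 4.
  by rewrite rhoE; field; rewrite gt_eqF.
have s4 : 0 <= (K - (16 * S + 2 * M)) / u ^+ 4.
  by rewrite divr_ge0 ?exprn_ge0 ?(ltW u0)//; lra.
have s5 : K * (u ^+ 2 - 1) / u ^+ 4 <= K / w ^+ 2.
  rewrite -mulrA ler_wpM2l// ler_pdivrMr ?exprn_gt0// mulrC.
  rewrite ler_pdivlMr ?exprn_gt0//.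
  apply: (le_trans (ler_wpM2l _ w2)); first lra.
  have -> : (u ^+ 2 - 1) * (u ^+ 2 + 1) = u ^+ 4 - 1 by ring.
  by lra.
rewrite mulrDr; lra.
Qed.

(** The sum is dominated by the integral of [s^(-1/3)], in the discrete form
    [s^(-1/3) <= 3/2 (s^(2/3) - (s-1)^(2/3))]. *)
Lemma sum_inv_cbrt T :
  \sum_(t < T) (cbrt (t + 9)%:R)^-1 <= 3 / 2 * cbrt (T + 8)%:R ^+ 2.
Proof.
elim: T => [|T IH]; first by rewrite big_ord0 mulr_ge0 ?sqr_ge0//; lra.
rewrite big_ord_recr /= addSnnS; move: IH.
set S := \sum_(_ < _) _; set w := cbrt _; set u := cbrt _ => IH.
have w0 : 0 < w by rewrite cbrt_gt0// ltr0n addnS.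
have u0 : 0 < u by rewrite cbrt_gt0// ltr0n addnS.
have uw3 : u ^+ 3 = w ^+ 3 + 1 by rewrite !cbrtK// natr1 addnS.
have uw : w <= u.
  by rewrite -(@ler_pXn2r _ 3) ?nnegrE ?(ltW w0) ?(ltW u0)// uw3 lerDl.
suff : u^-1 <= 3 / 2 * (u ^+ 2 - w ^+ 2) by lra.
rewrite -[leLHS]mul1r ler_pdivrMr//.
have /esym E : (u - w) * (u ^+ 2 + u * w + w ^+ 2) = 1.
  by apply: (addrI (w ^+ 3)); rewrite -uw3; ring.
rewrite [leLHS]E.
have -> : 3 / 2 * (u ^+ 2 - w ^+ 2) * u =
  (u - w) * (3 / 2 * u * (u + w)) by ring.
rewrite ler_wpM2l ?subr_ge0//; nra.
Qed.

(** For [8 <= T] one has [T + 8 <= 2 T], and 13/10 exceeds the cube root of 2. *)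
Lemma cbrt_shift T : (8 <= T)%N ->
  cbrt (T + 8)%:R ^+ 2 <= 169 / 100 * cbrt T%:R ^+ 2.
Proof.
move=> T8; have q0 := cbrt_ge0 T%:R.
have : cbrt (T + 8)%:R <= 13 / 10 * cbrt T%:R.
  apply: ler_cbrtX => //; first by rewrite mulr_ge0//; lra.
  have : (8 : R) <= T%:R by rewrite ler_nat.
  rewrite exprMn cbrtK// natrD; lra.
move=> h; rewrite (_ : 169 / 100 * _ = (13 / 10 * cbrt T%:R) ^+ 2); last by field.
by rewrite lerXn2r ?nnegrE ?cbrt_ge0// mulr_ge0//; lra.
Qed.

Lemma expr_one_sub_inv T : (1 <= T)%N -> (1 - T%:R^-1) ^+ T <= (expR 1)^-1 :> R.
Proof.
move=> T1; have T0 : 0 < T%:R :> R by rewrite ltr0n.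
rewrite -expRN; have -> : -1 = T%:R * - T%:R^-1 :> R by rewrite mulrN divff// gt_eqF.
rewrite expRM_natl lerXn2r ?nnegrE ?expR_ge0//.
  by rewrite subr_ge0 invf_le1// ler1n.
exact: expR_ge1Dx.
Qed.

Lemma contraction_iterate k (e b : nat -> R) T : 0 <= k <= 1 ->
  (forall t, (t < T)%N -> 0 <= b t) ->
  (forall t, (t < T)%N -> e t.+1 <= k * e t + b t) ->
  e T <= k ^+ T * e 0%N + \sum_(t < T) b t.
Proof.
move=> /andP[k0 k1]; elim: T => [|T IH] b0 rec.
  by rewrite expr0 mul1r big_ord0 addr0.
rewrite big_ord_recr /= addrA (le_trans (rec T _))// lerD2r.
have {}IH := IH (fun t tT => b0 t (ltnW tT)) (fun t tT => rec t (ltnW tT)).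
apply: (le_trans (ler_wpM2l k0 IH)); rewrite mulrDr exprS mulrA lerD2l.
rewrite ler_piMl// sumr_ge0// => t _; apply: b0.
by rewrite (ltn_trans (ltn_ord t)).
Qed.

End StepSizes.

(** * Borel measurability of vectors *)

Section BorelVectors.
Context {R : realType} {n : nat}.

Lemma closed_prod_set (X_ : 'I_n -> set R) :
  (forall i, compact (X_ i)) -> closed (prod_set X_).
Proof.
move=> cX; have -> : prod_set X_ = \bigcap_(i in setT) ((fun x => x 0 i) @^-1` X_ i).
  by apply/seteqP; split=> x xX; [move=> i _; exact: xX | move=> i; exact: xX].
apply: closed_bigI => i _; apply: preimage_closed => [x _|].
  exact: coord_continuous.
exact: compact_closed (@Rhausdorff R) (cX i).
Qed.

Lemma open_measurable_borel_rV (A : set 'rV[R]_n) :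
  open A -> measurable (A : set (borel_rV R n)).
Proof. by move=> oA; apply: sub_sigma_algebra. Qed.

Lemma closed_measurable_borel_rV (A : set 'rV[R]_n) :
  closed A -> measurable (A : set (borel_rV R n)).
Proof.
move=> /closed_openC /open_measurable_borel_rV mA.
by rewrite -(setCK A); exact: measurableC.
Qed.

(** The preimage of an open interval is the trace on [A] of the interior of
    [{y | A y -> f y in the interval}]. *)
Lemma relatively_continuous_measurable (A : set 'rV[R]_n) (f : 'rV[R]_n -> R) :
  (forall x, A x -> forall e, 0 < e -> \forall y \near x, A y -> `|f y - f x| < e) ->
  measurable_fun (A : set (borel_rV R n)) f.
Proof.
move=> cf mA; apply: (measurability _ (RGenOpens.measurableE R)) => //.
move=> _ [_ [a [b ->] <-]].
pose O : set 'rV[R]_n := interior [set y | A y -> `]a, b[%classic (f y)].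
have -> : A `&` f @^-1` `]a, b[ = A `&` O.
  apply/seteqP; split=> [x [Ax /=]|x [Ax /interior_subset /= /(_ Ax)]//].
  rewrite ?in_itv /= => /andP[af fb]; split => //.
  have e0 : 0 < Num.min (f x - a) (b - f x) by rewrite lt_min !subr_gt0 af fb.
  apply: filterS (cf x Ax _ e0) => y /[apply].
  rewrite lt_min !ltr_norml => /andP[/andP[? ?] /andP[? ?]].
  by rewrite /= in_itv /=; apply/andP; split; lra.
apply: measurableI => //; apply: open_measurable_borel_rV.
exact: open_interior.
Qed.

(** Every open set is a countable union of boxes with rational centres, and
    membership in a box is a condition on finitely many coordinates. *)
Lemma measurable_fun_rV d (T : measurableType d) (h : T -> 'rV[R]_n) :
  (forall i, measurable_fun setT (fun w => h w 0 i)) ->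
  measurable_fun setT (h : T -> borel_rV R n).
Proof.
move=> mh.
apply: (@measurability _ _ _ (borel_rV R n) setT h (@open 'rV[R]_n)) => //.
move=> _ [U oU <-]; rewrite setTI.
pose c (p : 'rV[rat]_n * nat) : 'rV[R]_n := map_mx ratr p.1.
pose r (p : 'rV[rat]_n * nat) : R := p.2.+1%:R^-1.
pose B p : set 'rV[R]_n := [set y | forall i, ball (c p 0 i) (r p) (y 0 i)].
have -> : h @^-1` U = \bigcup_p (h @^-1` (if `[< B p `<=` U >] then B p else set0)).
  apply/seteqP; split=> [w /= Uw|w [p _] /=]; last by case: asboolP => [BU /BU|_ []].
  have /nbhs_ballP[e /= e0 eU] : nbhs (h w) U by exact: open_nbhs_nbhs.
  have [k] : exists k, 0 + k.+1%:R^-1 < e / 2 :> R.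
    by apply: ltr_add_invr; rewrite divr_gt0.
  rewrite add0r; have : r (0, k) = k.+1%:R^-1 by [].
  have : 0 < r (0, k) by rewrite invr_gt0.
  move: (r _) => k' k0 rE ke; rewrite -rE in ke.
  have /choice[q qE] i : exists q : rat, ratr q \in `](h w 0 i - k'), (h w 0 i + k')[.
    by apply: rat_in_itvoo; lra.
  exists (\row_i q i, k) => //=; rewrite asboolT => [i|y By].
    rewrite !mxE /ball /= /r /= -rE ltr_norml; have := qE i.
    by rewrite in_itv /= => /andP[? ?]; apply/andP; split; lra.
  apply: eU; split=> // i j; rewrite !ord1; have := qE j; have := By j.
  rewrite !mxE /ball /= /r /= -rE !ltr_norml in_itv /= => /andP[? ?] /andP[? ?].
  by apply/andP; split; lra.
apply: countable_bigcupT_measurable => [|p]; first exact: countableP.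
case: asboolP => _; last by rewrite preimage_set0.
have -> : h @^-1` B p =
    \bigcap_(i in setT) ((fun w => h w 0 i) @^-1` ball (c p 0 i) (r p)).
  by apply/seteqP; split=> w wB; [move=> i _; exact: wB|move=> i; exact: wB].
apply: fin_bigcap_measurable => // i _; rewrite -[X in measurable X]setTI.
by apply: mh => //; apply: open_measurable; exact: ball_open.
Qed.

End BorelVectors.

(** * Independence of the past and the next sample *)

Section Freezing.
Context {dO dZ : measure_display} {Omega : measurableType dO} {Z : measurableType dZ}
  {R : realType} (Pr : probability Omega R) (P : probability Z R).

(** Conditioning on a sigma-algebra independent of [zeta]: in an expectation of
    [f (w, zeta w)], the second argument may be averaged out while the first is held
    fixed. The sub-sigma-algebra is made into a measurable space of its own, and
    independence says that the law of [w |-> (w, zeta w)] on the product is the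
    product measure. *)
Lemma freezing (G : set (set Omega)) (zeta : Omega -> Z)
    (f : g_sigma_algebraType G * Z -> \bar R) :
  <<s G >> `<=` measurable -> measurable_fun setT zeta ->
  (forall A B, <<s G >> A -> measurable B ->
    Pr (A `&` zeta @^-1` B) = Pr A * P B)%E ->
  measurable_fun setT f -> (forall p, 0 <= f p)%E ->
  (\int[Pr]_w f (w, zeta w) = \int[Pr]_w \int[P]_y f (w, y))%E.
Proof.
move=> sG mzeta indep mf f0.
pose i (w : Omega) : g_sigma_algebraType G := w.
have mi : measurable_fun setT i by move=> _ A /sG mA; rewrite setTI.
have mj : measurable_fun setT (fun w => (i w, zeta w)) by exact: measurable_fun_pair.
pose XI : {mfun Omega >-> g_sigma_algebraType G} :=
  HB.pack i (isMeasurableFun.Build _ _ _ _ _ mi).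
pose XJ : {mfun Omega >-> (g_sigma_algebraType G * Z)%type} :=
  HB.pack (fun w => (i w, zeta w)) (isMeasurableFun.Build _ _ _ _ _ mj).
transitivity (\int[distribution Pr XJ]_p f p)%E.
  by rewrite /distribution ge0_integral_pushforward.
transitivity (\int[distribution Pr XI \x P]_p f p)%E.
  apply: eq_measure_integral => A mA _; apply/esym.
  apply: product_measure_unique => [B B' mB mB'|//].
  exact: indep.
rewrite fubini_tonelli1// /distribution ge0_integral_pushforward//.
- exact: measurable_fun_fubini_tonelli_F.
- by move=> y _; apply: integral_ge0.
Qed.

End Freezing.

Section History.
Context {dO dZ : measure_display} {Omega : measurableType dO} {Z : measurableType dZ}
  {R : realType} (Pr : probability Omega R).
Implicit Types (z : nat -> {RV Pr >-> Z}) (s t : nat).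

(** [history z t] is a set of sets; its generating family is what turns [Omega] with
    the past up to time [t] into a measurable space. *)
Definition history_generator z t : set (set Omega) :=
  \bigcup_(s in [set s : nat | (1 <= s <= t)%N])
    preimage_set_system setT (z s) measurable.

Lemma history_measurable z t : history z t `<=` measurable.
Proof.
apply: smallest_sub; first exact: sigma_algebra_measurable.
by move=> _ [s _ [A mA <-]]; exact: measurable_funP.
Qed.

Lemma history_mono z s t : (s <= t)%N -> history z s `<=` history z t.
Proof.
move=> st; apply: smallest_sub; first exact: smallest_sigma_algebra.
move=> _ [r /= /andP[r1 rs] [A mA <-]]; apply: sub_sigma_algebra; exists r.
  by rewrite /= r1 (leq_trans rs).
by exists A.
Qed.

(** Events that constrain z 1, ..., z t one at a time form a generating
    pi-system, and on them independence is the product rule. *)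
Lemma history_indep (P : probability Z R) z t A B : iid_samples P z ->
  history z t A -> measurable B ->
  (Pr (A `&` z t.+1 @^-1` B) = Pr A * P B)%E.
Proof.
move=> [indep idd] hA mB.
have mzB : measurable (z t.+1 @^-1` B).
  by rewrite -[X in measurable X]setTI; exact: measurable_funP.
have PB : Pr (z t.+1 @^-1` B) = P B by exact: idd.
pose cyl (E : nat -> set Z) :=
  \bigcap_(s in [set s : nat | (s < t)%N]) (z s.+1 @^-1` E s).
pose G : set (set Omega) := [set cyl E | E in [set E | forall s, measurable (E s)]].
have mcyl E : (forall s, measurable (E s)) -> measurable (cyl E).
  move=> mE; apply: fin_bigcap_measurable => [|s _]; first exact: finite_II.
  by rewrite -[X in measurable X]setTI; exact: measurable_funP.
have hG : history z t `<=` <<s G >>.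
  apply: smallest_sub; first exact: smallest_sigma_algebra.
  move=> _ [s /= /andP[s1 st] [E mE <-]]; apply: sub_sigma_algebra.
  exists (fun r => if r == s.-1 then E else setT) => [r|].
    by case: ifP.
  rewrite setTI; apply/seteqP; split => w.
    by move=> /(_ s.-1); rewrite /= eqxx prednK// => /(_ st).
  by move=> zw r /= rt; case: eqP => // ->; rewrite prednK.
have GI : setI_closed G.
  move=> _ _ [E mE <-] [E' mE' <-]; exists (fun s => E s `&` E' s).
    by move=> s; exact: measurableI.
  by rewrite /cyl -bigcapI.
pose J : {fset nat} := [fset s in iota 0 t]%fset.
have JE : [set` J] = [set s : nat | (s < t)%N].
  by apply/seteqP; split => s /=; rewrite !inE mem_iota.
have pr (E : nat -> set Z) (mE : forall s, measurable (E s)) :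
    (Pr (cyl E `&` z t.+1 @^-1` B) = Pr (cyl E) * P B)%E.
  pose E' s := if s == t then B else E s.
  have mE' s : measurable (E' s) by rewrite /E'; case: ifP.
  have <- : cyl E' = cyl E by apply: eq_bigcapr => s /= st; rewrite /E' ltn_eqF.
  have := indep (t |` J)%fset E' mE'; rewrite bigcap_fsetU1 big_fsetU1 /=; last first.
    by rewrite !inE mem_iota /= ltnn.
  by rewrite -(indep J E' mE') JE {1 3}/E' eqxx PB setIC muleC.
have PB0 : 0 <= fine (P B) by rewrite fine_ge0.
have PBE : ((NngNum PB0)%:num%:E = P B)%E by rewrite fineK ?fin_num_measure.
have PE : (forall A, mscale (NngNum PB0) Pr A = Pr A * P B)%E.
  by move=> A'; rewrite /mscale PBE muleC.
rewrite -PE -[LHS]/(mrestr Pr mzB A).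
apply: (@g_sigma_algebra_measure_unique _ _ _ G _ (fun=> setT)) => //.
- by move=> _ [E mE <-]; exact: mcyl.
- by move=> _; exists (fun=> setT) => //; apply/seteqP; split.
- by rewrite bigcup_const.
- by move=> _ [E mE <-]; rewrite [RHS]PE; exact: pr.
- by move=> _; rewrite /mrestr ltey_eq fin_num_measure//; exact: measurableI.
- exact: hG.
Qed.

End History.

(** * Centred noise *)

Lemma probability_integral_cst d (S : measurableType d) (R : realType)
    (P : probability S R) (k : R) : (\int[P]_y k%:E = k%:E)%E.
Proof.
by rewrite (integral_cst P measurableT k%:E) [X in (_ * X)%E]probability_setT mule1.
Qed.

Section ZeroMeanNoise.
Context {R : realType} {n : nat}.

Lemma measurable_enorm_sqr d (T : measurableType d) (h : T -> 'rV[R]_n) :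
  (forall i, measurable_fun setT (fun w => h w 0 i)) ->
  measurable_fun setT (fun w => enorm (h w) ^+ 2).
Proof.
move=> mh; under eq_fun do rewrite enorm_sqr.
by apply: measurable_sum => i; exact: measurable_funX.
Qed.

(** The cross term vanishes. Square integrability of the noise makes its
    coordinates integrable, because [|a| <= 1 + a^2]. *)
Lemma zero_mean_noise d (Z : measurableType d) (P : probability Z R)
    (xi : Z -> 'rV[R]_n) (m u : 'rV[R]_n) (r S : R) :
  (forall i, measurable_fun setT (fun y => xi y 0 i)) ->
  (forall i, ('E_P[fun y => (xi y 0 i)%R] = (m 0 i)%:E)%E) ->
  ('E_P[fun y => (enorm (xi y - m) ^+ 2)%R] <= S%:E)%E ->
  (\int[P]_y (enorm (u + r *: (m - xi y)) ^+ 2)%:E <=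
    (enorm u ^+ 2 + r ^+ 2 * S)%:E)%E.
Proof.
move=> mxi; rewrite unlock => Exi ES.
pose N y := enorm (xi y - m) ^+ 2.
have mN : measurable_fun setT N.
  apply: measurable_enorm_sqr => i; under eq_fun do rewrite !mxE.
  exact: measurable_funB.
have iN : P.-integrable setT (EFin \o N).
  apply/integrableP; split; first exact/measurable_EFinP.
  under eq_integral do rewrite gee0_abs ?lee_fin ?sqr_ge0//.
  by rewrite (le_lt_trans ES)// ltry.
have icst k : P.-integrable setT (EFin \o cst k) by exact: finite_measure_integrable_cst.
have Ecst := probability_integral_cst P.
pose e i y := m 0 i - xi y 0 i.
have me i : measurable_fun setT (e i) by exact: measurable_funB.
have ie i : P.-integrable setT (EFin \o e i).
  apply: (@le_integrable _ _ _ _ _ _ _ (fun y => (1 + N y)%:E)) => //.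
  - exact/measurable_EFinP.
  - move=> y _; rewrite lee_fin [leRHS]ger0_norm ?addr_ge0 ?sqr_ge0//.
    have : `|e i y| <= enorm (xi y - m).
      by rewrite /e -normrN opprB; have := ler_coord_enorm (xi y - m) i; rewrite !mxE.
    by have := sqr_ge0 (enorm (xi y - m) - 1); rewrite /N; nra.
  - exact: (integrableD _ (icst 1) iN).
have Ee i : (\int[P]_y (e i y)%:E = 0)%E.
  have ixi : P.-integrable setT (EFin \o (fun y => xi y 0 i)).
    have := integrableB measurableT (icst (m 0 i)) (ie i).
    by apply: eq_integrable => // y _ /=; rewrite -EFinB /e opprB addrC subrK.
  rewrite (_ : (fun y => (e i y)%:E) = (fun y => (m 0 i)%:E - (xi y 0 i)%:E)%E)//.
  rewrite (@integralB_EFin _ _ _ _ _ (cst (m 0 i)))// Exi.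
  by rewrite Ecst subee.
have -> : (fun y => (enorm (u + r *: (m - xi y)) ^+ 2)%:E) =
    (fun y => (enorm u ^+ 2)%:E +
      (\sum_(i < n) (2 * r * u 0 i)%:E * (e i y)%:E + (r ^+ 2)%:E * (N y)%:E))%E.
  apply/funext => y; rewrite sumEFin -!EFinM -!EFinD; congr EFin.
  rewrite /N !enorm_sqr big_distrr -!big_split; apply: eq_bigr => i _.
  by rewrite !mxE /e /=; ring.
have ise i : P.-integrable setT (fun y => (2 * r * u 0 i)%:E * (e i y)%:E)%E.
  exact: integrableZl (ie i).
have isum := integrable_sum measurableT (index_enum 'I_n) (P := xpredT) (fun i _ => ise i).
have irN := integrableZl measurableT (r ^+ 2) iN.
rewrite integralD//; [|exact: icst|exact: integrableD].
rewrite integralD// integral_sum// integralZl//.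
rewrite big1 => [|i _]; last first.
  by rewrite (integralZl measurableT (ie i)) [X in (_ * X)%E]Ee mule0.
rewrite add0e Ecst EFinD leeD2l// (EFinM (r ^+ 2) S).
by rewrite lee_wpmul2l// lee_fin sqr_ge0.
Qed.

End ZeroMeanNoise.

(** * Analysis of the method *)

Section ScgMethod.
Context {R : realType} {n T : nat} {dZ dO : measure_display}
  {Z : measurableType dZ} {Omega : measurableType dO}
  (P : probability Z R) (Pr : probability Omega R)
  (X_ : 'I_n -> set R) (C : set 'rV[R]_n)
  (gFt : 'rV[R]_n -> Z -> 'rV[R]_n) (gF : 'rV[R]_n -> 'rV[R]_n)
  (D L sigma : R) (rho : nat -> R)
  (z : nat -> {RV Pr >-> Z}) (x d v : nat -> Omega -> 'rV[R]_n).
Let X := prod_set X_.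
Implicit Types (s t : nat) (w : Omega).

Hypothesis T_gt0 : (1 <= T)%N.
Hypothesis compact_X : forall i, compact (X_ i).
Hypothesis X_ge0 : forall i a, X_ i a -> 0 <= a.
Hypothesis convC : convex_set C.
Hypothesis CX : C `<=` X.
Hypothesis CX_box : forall y i a, C y -> 0 <= a <= y 0 i -> X_ i a.
Hypothesis C_nonempty : C !=set0.
Hypothesis run : scg_run C T rho gFt z x d v.

Lemma iterate_average t w : (t <= T)%N ->
  exists2 y, C y & x t w = (t%:R / T%:R) *: y.
Proof.
elim: t => [_|t IH tT].
  by have [y Cy] := C_nonempty; exists y => //; rewrite (scg_x0 run) mul0r scale0r.
have [y Cy xE] := IH (ltnW tT); have [Cv _] := scg_v run w tT.
by rewrite (scg_x run)// xE; exact: average_step convC _ _ _ _ Cy Cv.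
Qed.

Lemma iterate_domain t w : (t <= T)%N -> X (x t w).
Proof.
move=> tT; have [y Cy ->] := iterate_average w tT.
apply: (box_domain CX_box Cy) => i; have y0 := constraint_ge0 X_ge0 CX i Cy.
rewrite mxE mulr_ge0 ?divr_ge0//= ler_piMl//.
by rewrite ler_pdivrMr ?ltr0n// mul1r ler_nat.
Qed.

Local Notation past t := (g_sigma_algebraType (history_generator z t)).

Lemma past_mono s t d' (S : measurableType d') (f : Omega -> S) : (s <= t)%N ->
  measurable_fun setT (f : past s -> S) ->
  measurable_fun setT (f : past t -> S).
Proof.
by move=> st mf _ A mA; apply: (history_mono st); exact: mf.
Qed.

Lemma past_measurable t d' (S : measurableType d') (f : Omega -> S) :
  measurable_fun setT (f : past t -> S) ->
  measurable_fun setT f.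
Proof.
by move=> mf _ A mA; apply: (@history_measurable _ _ _ _ _ _ z t); exact: mf.
Qed.

Lemma sample_past t s : (1 <= t <= s)%N ->
  measurable_fun setT (z t : past s -> Z).
Proof.
by move=> ts _ A mA; apply: sub_sigma_algebra; exists t => //; exists A.
Qed.

Lemma direction_past t s i : (t < T)%N -> (t <= s)%N ->
  measurable_fun setT
    ((fun w => v t w 0 i) : past s -> R).
Proof.
move=> tT ts; apply: (past_mono ts).
have mv : measurable_fun setT (v t : past t -> borel_rV R n).
  by move=> _ A mA; apply: (scg_adapted run tT); exists A.
have mc : measurable_fun (setT : set (borel_rV R n)) (fun y : 'rV[R]_n => y 0 i).
  apply: relatively_continuous_measurable => y _ e e0.
  apply: filterS (enorm_near y e0) => y' + _; apply: le_lt_trans.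
  by have := ler_coord_enorm (y' - y) i; rewrite !mxE.
exact: (measurableT_comp mc mv).
Qed.

Lemma iterate_past t s i : (t <= T)%N -> (t <= s.+1)%N ->
  measurable_fun setT
    ((fun w => x t w 0 i) : past s -> R).
Proof.
elim: t => [_ _|t IH tT ts].
  by under eq_fun do rewrite (scg_x0 run) mxE; exact: measurable_cst.
under eq_fun do rewrite (scg_x run)// !mxE.
apply: measurable_funD; first exact: IH (ltnW tT) (ltnW ts).
by apply: measurable_funM; [exact: measurable_cst|exact: direction_past].
Qed.

Lemma iterate_past_borel t s : (t <= T)%N -> (t <= s.+1)%N ->
  measurable_fun setT
    (x t : past s -> borel_rV R n).
Proof. by move=> tT ts; apply: measurable_fun_rV => i; exact: iterate_past. Qed.

Lemma continuous_iterate_past (f : 'rV[R]_n -> R) t s : (t <= T)%N -> (t <= s.+1)%N ->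
  (forall y, X y -> forall e, 0 < e -> \forall y' \near y, X y' -> `|f y' - f y| < e) ->
  measurable_fun setT
    ((fun w => f (x t w)) : past s -> R).
Proof.
move=> tT ts cf.
apply: (@measurable_comp _ _ _ _ (borel_rV R n) _ (X : set (borel_rV R n))).
- by apply: closed_measurable_borel_rV; exact: closed_prod_set.
- by move=> _ [w _ <-]; exact: iterate_domain.
- exact: relatively_continuous_measurable.
- exact: iterate_past_borel.
Qed.

Hypothesis L_ge0 : 0 <= L.
Hypothesis lip_gF :
  forall y y', X y -> X y' -> enorm (gF y - gF y') <= L * enorm (y - y').
Hypothesis measurable_gFt : forall i,
  measurable_fun ((X : set (borel_rV R n)) `*` [set: Z])
    (fun p : borel_rV R n * Z => gFt p.1 p.2 0 i).

Lemma gradient_past t s i : (t <= T)%N -> (t <= s.+1)%N ->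
  measurable_fun setT
    ((fun w => gF (x t w) 0 i) : past s -> R).
Proof.
move=> tT ts; apply: (continuous_iterate_past (f := fun y => gF y 0 i)) => // y Xy e e0.
have k0 : 0 < e / (L + 1) by rewrite divr_gt0// ltr_wpDl.
apply: filterS (enorm_near y k0) => y' yy' Xy'.
have := ler_coord_enorm (gF y' - gF y) i; rewrite !mxE => /le_lt_trans; apply.
apply: (le_lt_trans (lip_gF Xy' Xy)).
move: yy'; rewrite ltr_pdivlMr ?ltr_wpDl//; have := enorm_ge0 (y' - y); nra.
Qed.

(** Stated for an arbitrary parameter space [S], it serves for the gradient actually
    sampled, for one with the past frozen, and jointly on the product of the two. *)
Lemma sampled_gradient_past d' (S : measurableType d') (h : S -> Omega) (y : S -> Z) t i :
  (t <= T)%N ->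
  measurable_fun setT ((fun p => x t (h p)) : S -> borel_rV R n) ->
  measurable_fun setT y ->
  measurable_fun setT (fun p => gFt (x t (h p)) (y p) 0 i).
Proof.
move=> tT mx my.
apply: (@measurable_comp _ _ _ S _ _ ((X : set (borel_rV R n)) `*` [set: Z])
  (fun p : borel_rV R n * Z => gFt p.1 p.2 0 i) setT (fun p => (x t (h p), y p))) => //.
- by apply: measurableX => //; apply: closed_measurable_borel_rV; exact: closed_prod_set.
- by move=> _ [w _ <-]; split => //; exact: iterate_domain.
- exact: measurable_fun_pair.
Qed.

Lemma momentum_past t s i : (t < T)%N -> (t <= s)%N ->
  measurable_fun setT
    ((fun w => d t w 0 i) : past s -> R).
Proof.
elim: t => [_ _|t IH tT ts].
  by under eq_fun do rewrite (scg_d0 run) mxE; exact: measurable_cst.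
under eq_fun do rewrite (scg_d run)// !mxE.
apply: measurable_funD; apply: measurable_funM; try exact: measurable_cst.
  exact: IH (ltnW tT) (ltnW ts).
apply: (@sampled_gradient_past _ (past s)
  (fun w => w) (z t.+1) t.+1 i) => //; first exact: ltnW.
  by apply: iterate_past_borel; [exact: ltnW|exact: leqW].
exact: sample_past.
Qed.

Definition gradient_error t w := gF (x t w) - d t w.

Lemma gradient_error_past t i : (t < T)%N ->
  measurable_fun setT
    ((fun w => gradient_error t w 0 i) : past t -> R).
Proof.
move=> tT; under eq_fun do rewrite !mxE.
by apply: measurable_funB; [apply: gradient_past => //; exact: ltnW|exact: momentum_past].
Qed.

Lemma measurable_error_sqr t : (t < T)%N ->
  measurable_fun setT (fun w => (enorm (gradient_error t w) ^+ 2)%:E).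
Proof.
move=> tT; apply/measurable_EFinP; apply: (@past_measurable t).
by apply: measurable_enorm_sqr => i; exact: gradient_error_past.
Qed.

Hypothesis C_bounded : forall y, C y -> enorm y <= D.
Hypothesis unbiased : forall y, X y -> forall i,
  ('E_P[fun a => (gFt y a 0 i)%R] = (gF y 0 i)%:E)%E.
Hypothesis variance : forall y, X y ->
  ('E_P[fun a => (enorm (gFt y a - gF y) ^+ 2)%R] <= (sigma ^+ 2)%:E)%E.
Hypothesis samples : iid_samples P z.

(** The new error is [(1 - rho) (Delta_t + drift) + rho noise], where the drift of
    the gradient is at most [L D / T] and the noise has zero mean given the past.
    Young's inequality with weight [rho/2] separates the drift. *)
Lemma error_step t : (t.+1 < T)%N -> 0 < rho t.+1 <= 1 ->
  (\int[Pr]_w (enorm (gradient_error t.+1 w) ^+ 2)%:E <=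
    ((1 - rho t.+1) ^+ 2 * (1 + rho t.+1 / 2))%:E *
      \int[Pr]_w (enorm (gradient_error t w) ^+ 2)%:E +
    ((1 - rho t.+1) ^+ 2 * ((1 + (rho t.+1 / 2)^-1) * ((L * D) ^+ 2 / T%:R ^+ 2)) +
      rho t.+1 ^+ 2 * sigma ^+ 2)%:E)%E.
Proof.
move=> tT; set r := rho t.+1 => /andP[r0 r1].
have tT' : (t < T)%N by exact: ltnW.
pose U w := (1 - r) *: (gF (x t.+1 w) - d t w).
pose f (p : past t * Z) : \bar R :=
  (enorm (U p.1 + r *: (gF (x t.+1 p.1) - gFt (x t.+1 p.1) p.2)) ^+ 2)%:E.
have mf : measurable_fun setT f.
  apply/measurable_EFinP; apply: measurable_enorm_sqr => i.
  pose W := past t.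
  have mfst (h : W -> R) : measurable_fun setT h ->
      measurable_fun setT (fun p : W * Z => h p.1).
    by move=> mh; exact: (measurableT_comp mh measurable_fst).
  have mg : measurable_fun setT (fun p : W * Z => gF (x t.+1 p.1) 0 i).
    by apply: (mfst (fun w => gF (x t.+1 w) 0 i)); exact: gradient_past.
  have md : measurable_fun setT (fun p : W * Z => d t p.1 0 i).
    by apply: (mfst (fun w => d t w 0 i)); exact: momentum_past.
  have ms : measurable_fun setT (fun p : W * Z => gFt (x t.+1 p.1) p.2 0 i).
    apply: (@sampled_gradient_past _ (W * Z)%type fst snd t.+1 i) => //.
    apply: measurableT_comp measurable_fst.
    exact: iterate_past_borel.
  under eq_fun do rewrite !mxE.
  apply: measurable_funD; apply: measurable_funM; try exact: measurable_cst;
    exact: measurable_funB.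
have fE w : (enorm (gradient_error t.+1 w) ^+ 2)%:E = f (w, z t.+1 w).
  rewrite /f /gradient_error (scg_d run)// -/r /U /=; congr ((enorm _ ^+ 2)%:E).
  by apply/rowP => i; rewrite !mxE; ring.
under eq_integral do rewrite fE.
have f0 p : (0 <= f p)%E by rewrite lee_fin sqr_ge0.
rewrite (@freezing _ _ _ _ _ Pr P _ (z t.+1))//; last 2 first.
- exact: history_measurable.
- by move=> A B hA mB; exact: history_indep.
set c1 := (1 - r) ^+ 2 * (1 + r / 2); set c2 := (X in (_ + X%:E)%E).
have c10 : 0 <= c1 by rewrite mulr_ge0 ?sqr_ge0//; lra.
have LD0 : 0 <= (L * D) ^+ 2 / T%:R ^+ 2 by rewrite divr_ge0 ?sqr_ge0.
have i0 : 0 <= 1 + (r / 2)^-1 by rewrite addr_ge0// invr_ge0; lra.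
have c20 : 0 <= c2.
  apply: addr_ge0; apply: mulr_ge0; rewrite ?sqr_ge0//.
  exact: mulr_ge0 i0 LD0.
have bound w : (\int[P]_y f (w, y) <= (c1 * enorm (gradient_error t w) ^+ 2 + c2)%:E)%E.
  have Xx : X (x t.+1 w) by apply: iterate_domain; exact: ltnW.
  have Xx' : X (x t w) by apply: iterate_domain; do 2 exact: ltnW.
  have mxi i : measurable_fun setT (fun y => gFt (x t.+1 w) y 0 i).
    by apply: (@sampled_gradient_past _ Z (fun=> w) id t.+1 i).
  apply: (le_trans (zero_mean_noise (U w) r mxi (unbiased Xx) (variance Xx))).
  rewrite lee_fin /c1 /c2 addrA lerD2r -mulrA -mulrDr.
  rewrite /U enormZ exprMn real_normK ?num_real// ler_wpM2l ?sqr_ge0//.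
  rewrite (_ : _ - _ = gradient_error t w + (gF (x t.+1 w) - gF (x t w))); last first.
    by rewrite /gradient_error [RHS]addrC addrA subrK.
  apply: (le_trans (enormD_young (b := r / 2) _ _ _)); first lra.
  rewrite lerD2l ler_wpM2l//.
  rewrite -expr_div_n lerXn2r ?nnegrE ?enorm_ge0//.
    rewrite divr_ge0// mulr_ge0// (le_trans (enorm_ge0 (v t w)))//.
    by apply: C_bounded; have [] := scg_v run w tT'.
  apply: (le_trans (lip_gF Xx Xx')); rewrite -mulrA ler_wpM2l//.
  rewrite (scg_x run)// addrC addKr enormZ ger0_norm ?invr_ge0// mulrC.
  by rewrite ler_wpM2r ?invr_ge0//; apply: C_bounded; have [] := scg_v run w tT'.
have mF : measurable_fun setT (fun w => \int[P]_y f (w, y))%E.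
  apply: (@past_measurable t); exact: measurable_fun_fubini_tonelli_F.
have mE := measurable_error_sqr tT'.
apply: (@le_trans _ _
  (\int[Pr]_w (c1%:E * (enorm (gradient_error t w) ^+ 2)%:E + c2%:E))%E).
  apply: ge0_le_integral => //.
  - by move=> w _; apply: integral_ge0.
  - by apply: emeasurable_funD => //; apply: emeasurable_funM.
have mcE : measurable_fun setT
    (fun w => c1%:E * (enorm (gradient_error t w) ^+ 2)%:E)%E.
  exact: emeasurable_funM.
have E0 w : (0 <= (enorm (gradient_error t w) ^+ 2)%:E)%E by rewrite lee_fin sqr_ge0.
have cE0 w : (0 <= c1%:E * (enorm (gradient_error t w) ^+ 2)%:E)%E.
  by rewrite mule_ge0.
rewrite ge0_integralD// ge0_integralZl_EFin//.
apply: leeD => //.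
by rewrite probability_integral_cst.
Qed.

Variable Q : R.
Hypothesis initial_error : 4 * enorm (gF 0) ^+ 2 <= Q.
Hypothesis step_error : 16 * sigma ^+ 2 + 2 * (L * D) ^+ 2 <= Q.
Hypothesis rhoE : forall t, rho t = 4 / cbrt (t + 8)%:R ^+ 2.

(** For [8 <= T] all the shifted times [t + 8] with [t < T] are at most [2 T], so that
    the drift [L D / T] contributes, like the noise, a term of order [rho^2]. The bound
    [Q / (t + 9)^(2/3)] does not follow from [4 |Delta_0|^2 <= Q] at [t = 0], because
    [9^(2/3)] exceeds 4; hence the constant [4 Q]. *)
Lemma error_bound t : (8 <= T)%N -> (t < T)%N ->
  (\int[Pr]_w (enorm (gradient_error t w) ^+ 2)%:E <=
    (4 * Q / cbrt (t + 9)%:R ^+ 2)%:E)%E.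
Proof.
move=> T8; have Q0 : 0 <= Q.
  by rewrite (le_trans _ initial_error)// mulr_ge0 ?sqr_ge0.
elim: t => [_|t IH tT].
  under eq_integral do rewrite /gradient_error (scg_x0 run) (scg_d0 run) subr0.
  rewrite probability_integral_cst lee_fin add0n.
  have w3 : cbrt 9%:R <= 3 :> R by apply: ler_cbrtX => //; rewrite -natrX ler_nat.
  have w0 : 0 < cbrt 9%:R :> R by apply: cbrt_gt0; rewrite ltr0n.
  have w9 : cbrt 9%:R ^+ 2 <= 9 :> R.
    apply: (@le_trans _ _ (3 ^+ 2)); last by rewrite -natrX.
    by rewrite lerXn2r ?nnegrE ?(ltW w0).
  rewrite ler_pdivlMr ?exprn_gt0//.
  have := ler_wpM2l (sqr_ge0 (enorm (gF 0))) w9; move: initial_error Q0; lra.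
have tT' : (t < T)%N by exact: ltnW.
have u0 : 2 <= cbrt (t.+1 + 8)%:R :> R.
  rewrite -(@ler_pXn2r _ 3) ?nnegrE ?cbrt_ge0// cbrtK// -natrX ler_nat.
  by rewrite addnC leq_addr.
have rho01 : 0 < rho t.+1 <= 1.
  rewrite rhoE divr_gt0 ?exprn_gt0//=; last lra.
  rewrite ler_pdivrMr ?exprn_gt0//; last lra.
  have := @lerXn2r _ 2 _ _ _ _ u0; rewrite !nnegrE cbrt_ge0 mul1r => h.
  by rewrite (le_trans _ (h _ _))// -natrX.
apply: (le_trans (error_step tT rho01)).
set r := rho t.+1; set c1 := (1 - r) ^+ 2 * (1 + r / 2).
have c10 : 0 <= c1.
  by rewrite mulr_ge0 ?sqr_ge0//; move/andP: rho01 => []; rewrite -/r; lra.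
apply: (le_trans (leeD2r _ (lee_wpmul2l _ (IH tT')))); first by rewrite lee_fin.
rewrite -EFinM -EFinD lee_fin /c1 addrA -(mulrA ((1 - r) ^+ 2)) -mulrDr.
rewrite -[X in cbrt (X)%:R]addSnnS.
apply: (error_recursion (rhoE t.+1)) => //.
- by apply: cbrt_gt0; rewrite ltr0n addnS.
- by rewrite !cbrtK// natr1 addnS.
- exact: sqr_ge0.
- exact: sqr_ge0.
- by apply: (le_trans step_error); move: Q0; lra.
- rewrite cbrtK// -natrM ler_nat mul2n -addnn leq_add//; exact: ltnW.
Qed.

Variable F : 'rV[R]_n -> R.
Hypothesis gradF : gradient_on X F gF.
Hypothesis antitone_gF : forall a b, X a -> X b -> lev a b -> lev (gF b) (gF a).
Hypothesis monF : monotone_on X F.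
Hypothesis F_ge0 : forall y, X y -> 0 <= F y.

Lemma zero_domain : X 0.
Proof. by have := iterate_domain point (leq0n T); rewrite (scg_x0 run). Qed.

Lemma radius_ge0 : 0 <= D.
Proof.
by have [y Cy] := C_nonempty; rewrite (le_trans (enorm_ge0 y))// C_bounded.
Qed.

Lemma ler_domain0 y : X y -> F 0 <= F y.
Proof.
by move=> Xy; apply: (monF zero_domain Xy) => i; rewrite mxE; exact: X_ge0 (Xy i).
Qed.

Lemma initial_gap y : C y -> F y - F 0 <= enorm (gF 0) * D.
Proof.
move=> Cy; have := @DR_concave _ _ _ _ _ gradF 0 y antitone_gF; rewrite add0r => h.
apply: (le_trans (h _ _)).
- by move=> i; rewrite mxE; exact: (constraint_ge0 X_ge0 CX i Cy).
- move=> t /andP[t0 t1]; rewrite add0r; apply: (box_domain CX_box Cy) => i.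
  have y0 := constraint_ge0 X_ge0 CX i Cy.
  by rewrite mxE mulr_ge0//= ler_piMl.
- by rewrite (le_trans (inner_le_enorm _ _))// ler_wpM2l ?enorm_ge0// C_bounded.
Qed.

(** Iterating the one-step bound contracts the initial gap by [(1 - 1/T)^T <= 1/e]. *)
Lemma greedy_gap y w : C y ->
  F y - F (x T w) <= (expR 1)^-1 * F y
    + \sum_(t < T) 2 * D / T%:R * enorm (gradient_error t w) + L * D ^+ 2 / (2 * T%:R).
Proof.
move=> Cy; have T0 : 0 < T%:R :> R by rewrite ltr0n.
have D0 := radius_ge0.
pose b t := 2 * D / T%:R * enorm (gradient_error t w) + L * D ^+ 2 / (2 * T%:R ^+ 2).
have k01 : 0 <= (1 - T%:R^-1 : R) <= 1.
  by apply/andP; split; rewrite ?subr_ge0 ?invf_le1 ?ler1n// gerBl invr_ge0 ltW.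
have b0 t : (t < T)%N -> 0 <= b t.
  by move=> _; rewrite addr_ge0 ?divr_ge0 ?mulr_ge0 ?sqr_ge0 ?enorm_ge0 ?invr_ge0 ?(ltW T0).
have rec t : (t < T)%N ->
    F y - F (x t.+1 w) <= (1 - T%:R^-1) * (F y - F (x t w)) + b t.
  move=> tT; rewrite (scg_x run)// /b addrA.
  exact: (greedy_step X_ge0 convC CX CX_box gradF antitone_gF monF C_bounded L_ge0
    lip_gF tT (iterate_average w (ltnW tT)) (scg_v run w tT) Cy).
have := contraction_iterate (e := fun t => F y - F (x t w)) k01 b0 rec.
have -> : \sum_(t < T) b t =
    \sum_(t < T) 2 * D / T%:R * enorm (gradient_error t w) + L * D ^+ 2 / (2 * T%:R).
  rewrite big_split /=; congr (_ + _); rewrite sumr_const card_ord -[LHS]mulr_natr.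
  by field; rewrite gt_eqF.
rewrite (scg_x0 run) addrA => /le_trans; apply; rewrite !lerD2r.
have F0 := F_ge0 zero_domain; have := ler_domain0 (CX Cy).
have : 0 <= (1 - T%:R^-1) ^+ T :> R by rewrite exprn_ge0//; case/andP: k01.
have := expr_one_sub_inv (R := R) T_gt0.
move=> e1 p0 yF; apply: (@le_trans _ _ ((1 - T%:R^-1) ^+ T * F y)).
  by rewrite ler_wpM2l//; lra.
by rewrite ler_wpM2r// (le_trans F0).
Qed.

Lemma value_measurable : measurable_fun setT (fun w => F (x T w)).
Proof.
apply: (@past_measurable T); apply: (continuous_iterate_past (f := F)) => //.
by move=> y Xy e e0; exact: (gradient_continuous gradF Xy e0).
Qed.

Lemma expectation_ge_cst c : (forall w, c <= F (x T w)) ->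
  (c%:E <= 'E_Pr[fun w => F (x T w)])%E.
Proof.
move=> cF; rewrite unlock.
have F0 w : 0 <= F (x T w) by apply: F_ge0; exact: iterate_domain.
(* A negative constant is not covered by the comparison of nonnegative integrals. *)
have [c0|c0] := leP 0 c; last first.
  apply: (@le_trans _ _ 0%E); first by rewrite lee_fin ltW.
  by apply: integral_ge0 => w _; rewrite lee_fin.
rewrite -[leLHS](probability_integral_cst Pr).
apply: ge0_le_integral => //; try by move=> w _; rewrite lee_fin.
exact/measurable_EFinP/value_measurable.
Qed.

(** Concavity from the origin gives [F y - F 0 <= |gF 0| D], and [|gF 0|] is at most
    [sqrt Q / 2]. This serves for small [T] and for [Q = 0]. *)
Lemma coarse_bound y : C y ->
  ((F y - D * Num.sqrt Q / 2)%:E <= 'E_Pr[fun w => F (x T w)])%E.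
Proof.
move=> Cy; apply: expectation_ge_cst => w.
have h0 := ler_domain0 (iterate_domain w (leqnn T)); have h1 := initial_gap Cy.
have h2 : enorm (gF 0) <= Num.sqrt Q / 2.
  rewrite ler_pdivlMr// -(ger0_norm (enorm_ge0 (gF 0))) -[leLHS]ger0_norm ?mulr_ge0//.
  by rewrite -sqrtr_sqr ler_wsqrtr// exprMn mulrC real_normK ?num_real// -natrX.
have := ler_wpM2r radius_ge0 h2; lra.
Qed.

(** Linearizing [2 |Delta_t| <= lam + |Delta_t|^2 / lam] at the size [lam] that the error
    bound predicts turns the bound on the mean square into one on the mean. *)
Lemma fine_bound y : (8 <= T)%N -> 0 < Q -> C y ->
  (((1 - (expR 1)^-1) * F y - 15 * D * Num.sqrt Q / cbrt T%:R
     - L * D ^+ 2 / (2 * T%:R))%:E <= 'E_Pr[fun w => F (x T w)])%E.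
Proof.
move=> T8 Q0 Cy; have T0 : 0 < T%:R :> R by rewrite ltr0n.
have D0 := radius_ge0.
set c := _ - _ - _.
have F0 w : 0 <= F (x T w) by apply: F_ge0; exact: iterate_domain.
have [c0|c0] := leP 0 c; last first.
  apply: (@le_trans _ _ 0%E); first by rewrite lee_fin ltW.
  by rewrite unlock; apply: integral_ge0 => w _; rewrite lee_fin.
pose lam t : R := 2 * Num.sqrt Q / cbrt (t + 9)%:R.
have lam0 t : 0 < lam t.
  by rewrite divr_gt0 ?mulr_gt0 ?sqrtr_gt0// cbrt_gt0// ltr0n addnS.
have lamE t : lam t ^+ 2 = 4 * Q / cbrt (t + 9)%:R ^+ 2.
  by rewrite expr_div_n exprMn sqr_sqrtr ?(ltW Q0)// -natrX.
pose k t := D / T%:R / lam t.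
have k0 t : 0 <= k t.
  exact: (divr_ge0 (divr_ge0 D0 (ltW T0)) (ltW (lam0 t))).
pose S := \sum_(t < T) k t * lam t ^+ 2.
have SE : S = 2 * (D * Num.sqrt Q) / T%:R * \sum_(t < T) (cbrt (t + 9)%:R)^-1.
  rewrite /S mulr_sumr; apply: eq_bigr => t _.
  rewrite /k expr2 mulrA mulfVK ?gt_eqF//.
  have c0' : 0 < cbrt (t + 9)%:R :> R by rewrite cbrt_gt0// ltr0n addnS.
  by rewrite /lam; field; rewrite !gt_eqF.
have S_le : 2 * S <= 15 * D * Num.sqrt Q / cbrt T%:R.
  rewrite SE; have q0 : 0 < cbrt T%:R :> R by exact: cbrt_gt0.
  have DQ0 : 0 <= D * Num.sqrt Q by rewrite mulr_ge0 ?sqrtr_ge0.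
  have := sum_inv_cbrt T (R := R); have := cbrt_shift (R := R) T8.
  set q := cbrt T%:R; set p := cbrt _; set s := \sum_(_ < _) _ => pq sp.
  have sq : s <= 15 / 4 * q ^+ 2 by have := sqr_ge0 q; lra.
  have TE : T%:R = q ^+ 3 by rewrite cbrtK.
  apply: (@le_trans _ _ (2 * (2 * (D * Num.sqrt Q) / T%:R * (15 / 4 * q ^+ 2)))).
    by rewrite ler_wpM2l// ler_wpM2l ?divr_ge0 ?mulr_ge0 ?(ltW T0).
  (* 2 * 2 * 15/4 = 15 *)
  rewrite TE le_eqVlt; apply/orP; left; apply/eqP; field.
  by rewrite gt_eqF.
pose G w := F (x T w) + \sum_(t < T) k t * enorm (gradient_error t w) ^+ 2.
have G_ge w : c + S <= G w.
  have := greedy_gap w Cy; rewrite /G.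
  have : \sum_(t < T) 2 * D / T%:R * enorm (gradient_error t w) <=
      S + \sum_(t < T) k t * enorm (gradient_error t w) ^+ 2.
    rewrite /S -big_split; apply: ler_sum => t _ /=.
    rewrite -mulrDr; set e := enorm _.
    have -> : 2 * D / T%:R * e = k t * (2 * e * lam t).
      by rewrite /k; field; rewrite !gt_eqF.
    (* [2 e lam <= lam^2 + e^2] *)
    rewrite ler_wpM2l//; have := sqr_ge0 (e - lam t); lra.
  rewrite /c; lra.
have mE t : (t < T)%N ->
    measurable_fun setT (fun w => (k t * enorm (gradient_error t w) ^+ 2)%:E).
  move=> tT; under eq_fun do rewrite EFinM.
  by apply: emeasurable_funM => //; exact: measurable_error_sqr.
have E0 t w : (0 <= (k t * enorm (gradient_error t w) ^+ 2)%:E)%E.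
  by rewrite lee_fin mulr_ge0 ?sqr_ge0.
have mS : measurable_fun setT
    (fun w => (\sum_(t < T) (k t * enorm (gradient_error t w) ^+ 2)%:E)%E).
  by apply: emeasurable_sum => t; exact: mE.
have mF : measurable_fun setT (fun w => (F (x T w))%:E).
  exact/measurable_EFinP/value_measurable.
have GE w : (G w)%:E =
    ((F (x T w))%:E + \sum_(t < T) (k t * enorm (gradient_error t w) ^+ 2)%:E)%E.
  by rewrite /G EFinD sumEFin.
have S0 : 0 <= S by apply: sumr_ge0 => t _; rewrite mulr_ge0 ?sqr_ge0.
have int_ge : ((c + S)%:E <= \int[Pr]_w (G w)%:E)%E.
  rewrite -[leLHS](probability_integral_cst Pr).
  apply: ge0_le_integral => //.
  - by move=> w _; rewrite lee_fin addr_ge0.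
  - by under eq_fun do rewrite GE; exact: emeasurable_funD.
  - by move=> w _; rewrite lee_fin.
have int_G : (\int[Pr]_w (G w)%:E <= 'E_Pr[fun w => F (x T w)] + S%:E)%E.
  under eq_integral do rewrite GE.
  rewrite expectation.unlock ge0_integralD//; last 2 first.
  - by move=> w _; rewrite lee_fin.
  - by move=> w _; apply: sume_ge0.
  have -> : S%:E = (\sum_(t < T) (k t * lam t ^+ 2)%:E)%E by rewrite sumEFin.
  rewrite leeD2l// ge0_integral_sum => [|//|t|t w _]; [|exact: mE|exact: E0].
  apply: lee_sum => t _.
  under eq_integral do rewrite EFinM.
  have sq0 w : setT w -> (0 <= (enorm (gradient_error t w) ^+ 2)%:E)%E.
    by move=> _; rewrite lee_fin sqr_ge0.
  rewrite (ge0_integralZl_EFin Pr measurableT sq0 (measurable_error_sqr (ltn_ord t)))//.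
  by rewrite (EFinM (k t) (lam t ^+ 2)) lee_wpmul2l ?lee_fin// lamE error_bound.
have := le_trans int_ge int_G; rewrite EFinD leeD2rE//.
Qed.

End ScgMethod.

Theorem theorem6 (R : realType) (n T : nat)
    (dZ dO : measure_display) (Z : measurableType dZ)
    (Omega : measurableType dO)
    (P : probability Z R) (Pr : probability Omega R)
    (X_ : 'I_n -> set R) (C : set 'rV[R]_n)
    (Ft : 'rV[R]_n -> Z -> R) (gFt : 'rV[R]_n -> Z -> 'rV[R]_n)
    (F : 'rV[R]_n -> R) (gF : 'rV[R]_n -> 'rV[R]_n)
    (D L sigma OPT : R)
    (z : nat -> {RV Pr >-> Z}) (x d v : nat -> Omega -> 'rV[R]_n) :
  let X := prod_set X_ in
  let rho := fun t : nat => 4 / ((t + 8)%:R `^ (2 / 3)) in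
  let Q := Num.max (4 * enorm (gF 0 - 0) ^+ 2)
                   (16 * sigma ^+ 2 + 2 * L ^+ 2 * D ^+ 2) in
  (1 <= T)%N ->
  (* the domain and the constraint set *)
  (forall i, compact (X_ i)) ->
  (forall i a, X_ i a -> 0 <= a) ->
  compact C -> convex_set C -> C `<=` X ->
  (* X_ i contains [0, y_i] for y in C, so that the iterates, which start at 0
     and move along C, stay in the domain of F *)
  (forall y i a, C y -> 0 <= a <= y 0 i -> X_ i a) ->
  (* the stochastic function, its mean, and their gradients *)
  (forall y w, X y -> 0 <= Ft y w) ->
  (forall y, X y -> measurable_fun setT (Ft y)) ->
  (forall y, X y -> ('E_P[Ft y] = (F y)%:E)%E) ->
  (forall w, gradient_on X (Ft ^~ w) (gFt ^~ w)) ->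
  gradient_on X F gF ->
  (forall i, measurable_fun ((X : set (borel_rV R n)) `*` [set: Z])
     (fun p : borel_rV R n * Z => gFt p.1 p.2 0 i)) ->
  (* (1) *)
  (forall y, C y -> enorm y <= D) ->
  (* (2) *)
  DR_submodular_on X F gF ->
  monotone_on X F ->
  0 <= L ->
  (forall y y', X y -> X y' -> enorm (gF y - gF y') <= L * enorm (y - y')) ->
  (* (3) *)
  (forall y i, X y -> ('E_P[fun w => (gFt y w 0 i)%R] = (gF y 0 i)%:E)%E) ->
  (forall y, X y ->
     ('E_P[fun w => (enorm (gFt y w - gF y) ^+ 2)%R] <= (sigma ^+ 2)%:E)%E) ->
  (* the SCG method *)
  iid_samples P z ->
  scg_run C T rho gFt z x d v ->
  is_max (F @` C) OPT ->
  ('E_Pr[fun w => F (x T w)] >=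
     ((1 - (expR 1)^-1) * OPT
        - 15 * D * Num.sqrt Q / (T%:R `^ (1 / 3))
        - L * D ^+ 2 / (2 * T%:R))%:E)%E.
Proof.
move=> X rho Q T1 cX X0 _ cC CX box Ft0 _ EFt _ gradF mgFt CD [_ anti] monF L0 lip.
move=> unb var smp run [[y Cy <-] ymax].
have C0 : C !=set0 by exists y.
have F0 u : X u -> 0 <= F u.
  move=> Xu; rewrite -lee_fin -EFt//; apply: expectation_ge0 => a; exact: Ft0.
have Q1 : 4 * enorm (gF 0) ^+ 2 <= Q by rewrite /Q subr0 le_max lexx.
have Q2 : 16 * sigma ^+ 2 + 2 * (L * D) ^+ 2 <= Q.
  have -> : 2 * (L * D) ^+ 2 = 2 * L ^+ 2 * D ^+ 2 by ring.
  by rewrite /Q le_max lexx orbT.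
have unb' u : X u -> forall i, ('E_P[fun a => (gFt u a 0 i)%R] = (gF u 0 i)%:E)%E.
  by move=> Xu i; exact: unb.
have rhoE t : rho t = 4 / cbrt (t + 8)%:R ^+ 2 by rewrite /rho powR_two_thirds.
rewrite -/(cbrt T%:R).
have D0 : 0 <= D := radius_ge0 C0 CD.
have q0 : 0 < cbrt T%:R :> R by rewrite cbrt_gt0// ltr0n.
have Fy0 : 0 <= F y by apply: F0; exact: CX.
have e0 : 0 <= (expR 1)^-1 :> R by rewrite invr_ge0 expR_ge0.
have L1 : 0 <= L * D ^+ 2 / (2 * T%:R) by rewrite divr_ge0 ?mulr_ge0 ?sqr_ge0.
have coarse : D * Num.sqrt Q / 2 <= 15 * D * Num.sqrt Q / cbrt T%:R ->
    (((1 - (expR 1)^-1) * F y - 15 * D * Num.sqrt Q / cbrt T%:R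
     - L * D ^+ 2 / (2 * T%:R))%:E <= 'E_Pr[fun w => F (x T w)])%E.
  move=> DQ.
  apply: le_trans (coarse_bound T1 cX X0 cC CX box C0 run CD Q1 gradF anti monF F0 Cy).
  by rewrite lee_fin; have := mulr_ge0 e0 Fy0; lra.
(* When [T^(1/3) <= 2] the error allowed is already more than [D sqrt Q / 2]. *)
have [T8|T8] := leqP 8 T; last first.
  apply: coarse; have q2 : cbrt T%:R <= 2 :> R.
    by apply: ler_cbrtX => //; rewrite -natrX ler_nat ltnW.
  have DQ0 : 0 <= D * Num.sqrt Q by rewrite mulr_ge0 ?sqrtr_ge0.
  rewrite ler_pdivlMr//; have := ler_wpM2l DQ0 q2; lra.
have [Q0|Q0] := ltP 0 Q; last first.
  by apply: coarse; rewrite ler0_sqrtr// !mulr0 !mul0r.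
exact: (fine_bound T1 cX X0 cC CX box C0 run L0 lip mgFt CD unb' var smp Q1 Q2 rhoE
  gradF anti monF F0 T8 Q0 Cy).
Qed.
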